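(* Let $\alpha\in(0,1)$ be irrational. If $\beta\in\mathbb{T}^1$ is in $H_4(\alpha)$, then $$\sum_{n\in\mathbb{Z},\,n\ne0}\frac{1}{n^2}\frac{\|n\beta\|^4}{\|n\alpha\|^2}<\infty.$$ If $\beta,\gamma$ are in $H_4(\alpha)$, then $$\sum_{n\in\mathbb{Z},\,n\ne0}\frac{1}{n^2}\frac{\|n\beta\|^2\,\|n\gamma\|^2}{\|n\alpha\|^2}<\infty,$$ and there is $\psi_{\beta,\gamma}\in L^2(\mathbb{T}^1)$ which is a solution of $$1_{[0,\beta]}-T_\gamma 1_{[0,\beta]}=\psi_{\beta,\gamma}-T_\alpha\psi_{\beta,\gamma}\quad\text{a.e.}$$
   Context: $\mathbb{T}^1=\mathbb{R}/\mathbb{Z}$ with Lebesgue measure; elements of $\mathbb{T}^1$ are identified with their representatives in $[0,1)$. For $u\in\mathbb{R}$, $\|u\|=\inf_{n\in\mathbb{Z}}|u-n|$. For a function $f$ on $\mathbb{T}^1$ and $\gamma\in\mathbb{R}$, $T_\gamma f(x)=f(x+\gamma)$ (arguments modulo 1). Continued fractions: $\alpha=[0;a_1,a_2,\dots]$ with convergents $p_n/q_n$ ($q_{-1}=0$, $q_0=1$, $q_n=a_nq_{n-1}+q_{n-2}$). For $r\ge1$, $H_r(\alpha)$ is the set of $\beta\in\mathbb{T}^1$ which can be written $\beta=\sum_{j\ge1}b_jq_j\alpha \bmod 1$ with integers $b_j\in\mathbb{Z}$ such that $\sum_{j\ge1}|b_j|^r/a_{j+1}<\infty$. *)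

(* Defs.v *)
From HB Require Import structures.
From mathcomp Require Import all_boot all_order all_algebra.
From mathcomp Require Import all_classical all_reals all_analysis.
Set Implicit Arguments.
Unset Strict Implicit.
Unset Printing Implicit Defensive.
Import Order.TTheory GRing.Theory Num.Theory.
Import numFieldNormedType.Exports.
Local Open Scope classical_set_scope.
Local Open Scope ring_scope.

Definition frac_part (R : realType) (x : R) : R := x - (Num.floor x)%:~R.

(* ||u||, the distance from u to the nearest integer *)
Definition dist_int (R : realType) (u : R) : R :=
  inf (range (fun n : int => `|u - n%:~R|)).

(* For alpha irrational in (0,1): the complete remainders
   alpha_0 = alpha, alpha_{n+1} = {1 / alpha_n} ... *)
Definition cf_rem (R : realType) (alpha : R) (n : nat) : R :=
  iter n (fun x : R => frac_part x^-1) alpha.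

(* ... and the partial quotients a_{n+1} = floor (1 / alpha_n), so that
   alpha = [0; a_1, a_2, ...]; the index is the usual one, and a_0 = 0 *)
Definition cf_digit (R : realType) (alpha : R) (n : nat) : nat :=
  if n is m.+1 then Num.truncn (cf_rem alpha m)^-1 else 0%N.

(* Denominators of the convergents, with q_0 = 1; the second case is the
   recurrence q_1 = a_1 q_0 + q_{-1} with q_{-1} = 0 *)
Fixpoint cf_den (R : realType) (alpha : R) (n : nat) {struct n} : nat :=
  match n with
  | 0 => 1%N
  | m.+1 => match m with
            | 0 => cf_digit alpha 1
            | k.+1 => (cf_digit alpha n * cf_den alpha m + cf_den alpha k)%N
            end
  end.

(* H_r(alpha), with points of the circle R/Z represented in [0, 1[;
   the first clause on b is convergence of the series to beta modulo 1 *)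
Definition H (R : realType) (r alpha : R) : set R :=
  [set beta : R | 0 <= beta < 1 /\
    exists b : nat -> int,
      [/\ (fun n : nat => dist_int (beta -
             \sum_(1 <= j < n) (b j)%:~R * (cf_den alpha j)%:R * alpha))
            @ \oo --> (0 : R)
        & (\sum_(1 <= j <oo)
             (`|(b j)%:~R : R| `^ r / (cf_digit alpha j.+1)%:R)%:E
           < +oo)%E]].

(* Lebesgue measure of R/Z, carried by the representatives in [0, 1[;
   functions on R/Z are functions on R of which only the values on [0, 1[
   matter *)
Definition circle_measure (R : realType) :
    {measure set (measurableTypeR R) -> \bar R} :=
  mrestr (@lebesgue_measure R) (measurable_itv `[0%R, 1%R[ :
    measurable (`[0%R, 1%R[%classic : set (measurableTypeR R))).

Definition translate (R : realType) (gamma : R) (f : R -> R) : R -> R :=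
  fun x => f (frac_part (x + gamma)).

(* Main.v *)
Require Import Defs.
From HB Require Import structures.
From mathcomp Require Import all_boot all_order all_algebra.
From mathcomp Require Import all_classical all_reals all_analysis.
From mathcomp Require Import measurable_realfun.
From mathcomp Require Import ring lra zify.
Import Order.TTheory GRing.Theory Num.Theory.
Import numFieldNormedType.Exports.
Local Open Scope classical_set_scope.
Local Open Scope ring_scope.
Set Implicit Arguments.
Unset Strict Implicit.

(** Write q_j for the denominators and a_j for the partial quotients of alpha,
and let || . || be the distance to the nearest integer.

_Convergence of the sums._  Call the first series the energy of beta.  Each
of its terms is continuous in beta, so it is enough to bound uniformly the
energy of a finite sum beta = \sum_j b_j q_j alpha in terms of T = \sum_j |b_j|^4 / a_{j+1}; this is
[energy_den_le], which gives C (T + T^2 + T^4).  For q_m <= n < q_{m+1} one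
uses || n q_j alpha || <= q_j || n alpha || when j < m and
|| n q_j alpha || <= n || q_j alpha || when j > m, and both bounds when j = m.
What remains are sums of 1 / (|| n alpha || + eps)^2 over q_m consecutive n;
the points n alpha are then 1 / (2 q_m)-separated modulo 1 (best
approximation), so [block_sum_le] compares them with a sum over an arithmetic
progression.  The contributions j < m and j > m are summed over m by the
geometric growth of the q_m: they only cost \sum_j |b_j| / a_{j+1} <= T, since
the b_j are integers.  The term j = m is the one that costs
|b_m|^4 / a_{m+1}.  The mixed series follows from the first one by the
inequality between the arithmetic and the geometric mean.

_Solution of the cohomological equation._  With sigma the fractional part,
1_[0,beta] - beta is sigma(x - beta) - sigma(x) almost everywhere, so the
left-hand side of the equation is f(x - beta) - f(x) where
f(x) = sigma(x) - sigma(x + gamma).  When beta is replaced by an integer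
multiple k alpha, the equation is solved by a finite sum of translates of f
([increment_coboundary]).  Passing from one finite sum
\sum_{j < N} b_j q_j alpha to the next adds such an increment, and the solution
is the sum of the increments along a sparse sequence of N, provided that their
L^2 norms are small.  Parseval's identity for these finite sums is elementary:
the square of a difference of two translates of sigma takes two values, and
its integral is t (1 - t) with t the fractional part of the difference of the
translations ([integral_sawtooth_sqr]); expanding
t (1 - t) = (2 / pi^2) \sum_k sin^2(pi k t) / k^2 ([parabola_frac_cvg], obtained
from the exact finite identity [sum_sin2_ratio] at rational points) turns the
norm into \sum_n |c_n|^2 / n^2, where c_n is a quotient of three factors of the
form 1 - exp (2 pi i n x), and this is at most 8 times the mixed series ([orbit_sum_L2]).  So the norm of an
increment is controlled by the mixed energy of beta_{N'} - beta_N and gamma,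
which tends to 0 by the first part. *)

(** * Distance to the nearest integer *)

Section dist.
Variable R : realType.
Implicit Types u v : R.

Lemma dist_int_le u (m : int) : dist_int u <= `|u - m%:~R|.
Proof.
apply: ge_inf; last by exists m.
by exists 0 => _ [n _ <-].
Qed.

(** The infimum is attained, at the floor of u + 1/2. *)
Lemma dist_int_round u : exists m : int, dist_int u = `|u - m%:~R| /\ `|u - m%:~R| <= 1/2.
Proof.
pose m := Num.floor (u + 1/2); exists m.
have /andP[m1 m2] : (m%:~R <= u + 1/2) && (u + 1/2 < m%:~R + 1).
  by have := floor_itv (u + 1/2); rewrite intrD.
have mh : `|u - m%:~R| <= 1/2 by rewrite ler_norml; apply/andP; split; lra.
split=> //; apply/eqP; rewrite eq_le dist_int_le /=.
apply: lb_le_inf; first by exists `|u - 0%:~R|, 0.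
move=> _ [n _ <-].
have [->//|nm] := eqVneq n m.
have : 1 <= `|(n - m)%:~R : R|.
  by rewrite -intr_norm -[1]/(1%:~R) ler_int; move: nm; rewrite -subr_eq0 -normr_gt0.
rewrite intrB => h.
have := ler_normD (n%:~R - u) (u - m%:~R).
rewrite addrA subrK [`|n%:~R - u|]distrC; lra.
Qed.

Lemma dist_int_ge0 u : 0 <= dist_int u.
Proof. by have [m [-> _]] := dist_int_round u. Qed.

Lemma dist_int_le_half u : dist_int u <= 1/2.
Proof. by have [m [-> ]] := dist_int_round u. Qed.

Lemma dist_int_le1 u : dist_int u <= 1.
Proof. by have := dist_int_le_half u; lra. Qed.

Lemma dist_int_le_norm u : dist_int u <= `|u|.
Proof. by have := dist_int_le u 0; rewrite subr0. Qed.

Lemma dist_intD u v : dist_int (u + v) <= dist_int u + dist_int v.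
Proof.
have [m [-> _]] := dist_int_round u; have [k [-> _]] := dist_int_round v.
apply: le_trans (dist_int_le _ (m + k)) _.
by rewrite intrD opprD addrACA ler_normD.
Qed.

Lemma dist_intN u : dist_int (- u) = dist_int u.
Proof.
have H v : dist_int (- v) <= dist_int v.
  have [m [-> _]] := dist_int_round v.
  by apply: le_trans (dist_int_le _ (- m)) _; rewrite intrN -opprD normrN.
by apply/eqP; rewrite eq_le H /=; have := H (- u); rewrite opprK.
Qed.

Lemma dist_intMn (n : nat) u : dist_int (n%:R * u) <= n%:R * dist_int u.
Proof.
have [m [-> _]] := dist_int_round u.
apply: le_trans (dist_int_le _ (n%:Z * m)) _.
by rewrite intrM -mulrBr normrM normr_nat.
Qed.

Lemma dist_intMz (n : int) u : dist_int (n%:~R * u) <= `|n%:~R| * dist_int u.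
Proof.
have [m [-> _]] := dist_int_round u.
apply: le_trans (dist_int_le _ (n * m)) _.
by rewrite intrM -mulrBr normrM.
Qed.

Lemma dist_int_sum I (r : seq I) (F : I -> R) :
  dist_int (\sum_(i <- r) F i) <= \sum_(i <- r) dist_int (F i).
Proof.
elim/big_rec2: _ => [|i x y _ h]; first by have := dist_int_le_norm 0; rewrite normr0.
by apply: le_trans (dist_intD _ _) _; rewrite lerD2l.
Qed.

Lemma dist_int_dist u v : `|dist_int u - dist_int v| <= dist_int (u - v).
Proof.
rewrite ler_norml; apply/andP; split.
  have := dist_intD (- (u - v)) u; rewrite dist_intN opprB subrK; lra.
by have := dist_intD (u - v) v; rewrite subrK; lra.
Qed.

End dist.

(** * Continued fractions and best approximation *)

Section continued_fraction.
Variables (R : realType) (alpha : R).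
Hypotheses (alpha01 : 0 < alpha < 1) (alpha_irr : irrational alpha).

Let q := cf_den alpha.
Let a := cf_digit alpha.

Lemma irrational_neq_ratio (x : R) (m k : int) :
  irrational x -> k != 0 -> k%:~R * x != m%:~R.
Proof.
move=> xi k0; apply/negP => /eqP h; apply: xi.
exists (m%:~R / k%:~R) => //.
rewrite fmorph_div /= !ratr_int -h mulrAC divff ?mul1r // intr_eq0 //.
Qed.

Lemma irrational_inv (x : R) : irrational x -> irrational x^-1.
Proof. by move=> xi [r _ h]; apply: xi; exists r^-1 => //; rewrite fmorphV /= h invrK. Qed.

Lemma irrational_frac (x : R) : irrational x -> irrational (frac_part x).
Proof.
move=> xi [r _ h]; apply: xi; exists (r + (Num.floor x)%:~R) => //.
by rewrite rmorphD /= ratr_int h subrK.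
Qed.

Lemma frac_part_itv (x : R) : 0 <= frac_part x < 1.
Proof. by have := floor_itv x; rewrite /frac_part intrD; lra. Qed.

Lemma irrational_neq0 (x : R) : irrational x -> x != 0.
Proof. by move=> xi; apply/eqP => x0; apply: xi; exists 0 => //; rewrite rmorph0 x0. Qed.

Lemma cf_rem_irr n : irrational (cf_rem alpha n) /\ 0 < cf_rem alpha n < 1.
Proof.
elim: n => [//|n [ni _]]; rewrite /cf_rem iterS -/(cf_rem alpha n).
have hi := irrational_frac (irrational_inv ni); split => //.
have /andP[h0 ->] := frac_part_itv (cf_rem alpha n)^-1.
by rewrite lt_neqAle h0 eq_sym irrational_neq0.
Qed.

Lemma cf_rem_gt0 n : 0 < cf_rem alpha n.
Proof. by have [_ /andP[]] := cf_rem_irr n. Qed.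

Lemma cf_rem_lt1 n : cf_rem alpha n < 1.
Proof. by have [_ /andP[]] := cf_rem_irr n. Qed.

Lemma cf_rem_step n : cf_rem alpha n.+1 = (cf_rem alpha n)^-1 - (a n.+1)%:R.
Proof.
rewrite /cf_rem iterS -/(cf_rem alpha n) /frac_part /a /cf_digit truncn_floor.
have r0 := cf_rem_gt0 n.
have f0 : 0 <= Num.floor (cf_rem alpha n)^-1 by rewrite floor_ge0 invr_ge0 ltW.
by rewrite invr_ge0 (ltW r0) natr_absz ger0_norm.
Qed.

Lemma cf_digit_gt0 n : (0 < a n.+1)%N.
Proof.
rewrite /a /cf_digit truncn_gt0.
by rewrite -[1]invr1 lef_pV2 ?posrE ?ltr01 // ?cf_rem_gt0 // ltW // cf_rem_lt1.
Qed.

Lemma cf_denSS n : q n.+2 = (a n.+2 * q n.+1 + q n)%N.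
Proof. by []. Qed.

Lemma cf_den0 : q 0 = 1%N. Proof. by []. Qed.
Lemma cf_den1 : q 1 = a 1. Proof. by []. Qed.

Lemma cf_den_gt0 n : (0 < q n)%N.
Proof.
have H : (0 < q n)%N && (0 < q n.+1)%N; last by case/andP: H.
elim: n => [|n /andP[h1 h2]]; first by rewrite cf_den1 cf_digit_gt0.
by rewrite h2 cf_denSS addn_gt0 h1 orbT.
Qed.

Lemma cf_den_leS n : (q n <= q n.+1)%N.
Proof.
case: n => [|n]; first by rewrite cf_den_gt0.
by rewrite cf_denSS; apply: leq_trans (leq_addr _ _); rewrite leq_pmull // cf_digit_gt0.
Qed.

Lemma cf_den_addS n : (q n + q n.+1 <= q n.+2)%N.
Proof. by rewrite cf_denSS addnC leq_add2r leq_pmull // cf_digit_gt0. Qed.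

Lemma cf_digit_mul_le n : (a n.+1 * q n <= q n.+1)%N.
Proof. by case: n => [|n]; [rewrite muln1|rewrite cf_denSS leq_addr]. Qed.

Lemma cf_den_le_mul n : (q n.+1 <= (a n.+1).+1 * q n)%N.
Proof.
case: n => [|n]; first by rewrite cf_den1 cf_den0 muln1.
by rewrite cf_denSS mulSn addnC leq_add2r cf_den_leS.
Qed.

Lemma cf_den_geS n : (n <= q n)%N.
Proof.
have H : (n <= q n)%N && (n.+1 <= q n.+1)%N; last by case/andP: H.
elim: n => [|n /andP[h1 h2]]; first by rewrite cf_den_gt0.
rewrite h2 /=; apply: leq_trans (cf_den_addS n).
by apply: (leq_trans (n := (q n + n.+1)%N)); rewrite ?leq_add2l // -add1n leq_add2r cf_den_gt0.
Qed.

(** The product of the first n remainders; for n > 0 it is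
|q_{n-1} alpha - p_{n-1}|, and it satisfies the recurrence of the denominators run
backwards. *)
Definition cf_err n : R := \prod_(i < n) cf_rem alpha i.
Local Notation e := cf_err.

Lemma cf_err_gt0 n : 0 < e n.
Proof. by apply: prodr_gt0 => i _; exact: cf_rem_gt0. Qed.

Lemma cf_errS n : e n.+1 = e n * cf_rem alpha n.
Proof. by rewrite /e big_ord_recr. Qed.

Lemma cf_errSS n : e n.+2 = e n - (a n.+1)%:R * e n.+1.
Proof.
rewrite !cf_errS cf_rem_step mulrBr -mulrA divff ?mulr1 ?gt_eqF ?cf_rem_gt0 //.
by rewrite [X in _ - X]mulrC.
Qed.

(** The determinant identity in terms of the errors; it gives
1 / (2 q_{n+1}) <= |q_n alpha - p_n| <= 1 / q_{n+1}. *)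
Lemma cf_den_err n : (q n.+1)%:R * e n.+1 + (q n)%:R * e n.+2 = 1.
Proof.
elim: n => [|n IH].
  rewrite cf_errSS cf_den1 cf_den0 /e big_ord0; ring.
apply: etrans IH; rewrite cf_denSS [e n.+3]cf_errSS natrD natrM; ring.
Qed.

Lemma cf_err_le n : (q n.+1)%:R * e n.+1 <= 1.
Proof.
have := cf_den_err n; have : 0 <= (q n)%:R * e n.+2 by rewrite mulr_ge0 // ltW // cf_err_gt0.
lra.
Qed.

Lemma cf_err_leS n : e n.+1 <= e n.
Proof. by rewrite /e big_ord_recr /= ler_piMr ?(ltW (cf_err_gt0 _)) // ltW // cf_rem_lt1. Qed.

Lemma cf_err_ge n : 1 <= 2 * (q n.+1)%:R * e n.+1.
Proof.
rewrite -[leLHS](cf_den_err n).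
have : (q n)%:R * e n.+2 <= (q n.+1)%:R * e n.+1.
  by apply: ler_pM; rewrite ?ler_nat ?cf_den_leS ?cf_err_leS // ltW // cf_err_gt0.
lra.
Qed.

Fixpoint cf_num (n : nat) : int :=
  match n with
  | 0 => 0
  | m.+1 => if m is k.+1 then (a n)%:Z * cf_num m + cf_num k else 1
  end.
Local Notation p := cf_num.

Lemma cf_numSS n : p n.+2 = (a n.+2)%:Z * p n.+1 + p n. Proof. by []. Qed.

(** The signs of q_n alpha - p_n alternate, which is what drives [best_approx]. *)
Lemma cf_approx n : (q n)%:R * alpha - (p n)%:~R = (-1) ^+ n * e n.+1.
Proof.
have H : (q n)%:R * alpha - (p n)%:~R = (-1) ^+ n * e n.+1 /\
   (q n.+1)%:R * alpha - (p n.+1)%:~R = (-1) ^+ n.+1 * e n.+2; last by case: H.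
elim: n => [|n [h1 h2]].
  split; first by rewrite cf_den0 /e big_ord1 /cf_rem /=; ring.
  rewrite cf_errSS cf_den1 /e big_ord0 big_ord1 /cf_rem /= expr1; ring.
split=> //; rewrite cf_denSS [e n.+3]cf_errSS cf_numSS natrD natrM intrD intrM.
rewrite !exprS in h1 h2 *.
transitivity ((a n.+2)%:R * ((q n.+1)%:R * alpha - (p n.+1)%:~R) + ((q n)%:R * alpha - (p n)%:~R)).
  rewrite -[(a n.+2)%:~R]/((a n.+2)%:R); ring.
rewrite h1 h2; ring.
Qed.

Lemma cf_det n : p n.+1 * (q n)%:Z - p n * (q n.+1)%:Z = (-1) ^+ n.
Proof.
elim: n => [|n IH]; first by rewrite cf_den0 /= mulr1 mul0r subr0.
rewrite cf_numSS cf_denSS exprS -IH PoszD PoszM; ring.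
Qed.

Lemma dist_int_den n : dist_int ((q n)%:R * alpha) <= e n.+1.
Proof.
apply: le_trans (dist_int_le _ (p n)) _.
by rewrite cf_approx normrM normrX normrN1 expr1n mul1r ger0_norm // ltW // cf_err_gt0.
Qed.

(** In the basis formed by two successive convergents, a pair (k, z) has
coordinates x and y up to sign.  If these have the same sign the two errors add
up, which gives the bound; otherwise the two denominators add up and
k >= q_{n+1}. *)
Lemma best_approx n (k : nat) : (0 < k < q n.+1)%N -> e n.+1 <= dist_int (k%:R * alpha).
Proof.
move=> /andP[k0 kq]; have [z [-> _]] := dist_int_round (k%:R * alpha).
pose x : int := k%:Z * p n.+1 - z * (q n.+1)%:Z.
pose y : int := k%:Z * p n - z * (q n)%:Z.
have det := cf_det n.
have hk : k%:Z = (-1) ^+ n * (x * (q n)%:Z - y * (q n.+1)%:Z).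
  transitivity (((-1) ^+ n) ^+ 2 * k%:Z); first by rewrite sqrr_sign mul1r.
  rewrite expr2 -{2}det /x /y; ring.
have hz' : z = (-1) ^+ n * (x * p n - y * p n.+1).
  transitivity (((-1) ^+ n) ^+ 2 * z); first by rewrite sqrr_sign mul1r.
  rewrite expr2 -{2}det /x /y; ring.
clearbody x y.
have hz : k%:R * alpha - z%:~R = x%:~R * e n.+1 + y%:~R * e n.+2.
  have h1 := cf_approx n; have h2 := cf_approx n.+1.
  have -> : k%:R = (-1) ^+ n * (x%:~R * (q n)%:R - y%:~R * (q n.+1)%:R) :> R.
    by rewrite -[k%:R]/(k%:~R) hk intrM rmorphXn /= intrN intrB !intrM.
  have -> : z%:~R = (-1) ^+ n * (x%:~R * (p n)%:~R - y%:~R * (p n.+1)%:~R) :> R.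
    by rewrite {1}hz' intrM rmorphXn /= intrN intrB !intrM.
  move: h1 h2; move: (p n) (p n.+1) => p0 p1 h1 h2.
  transitivity ((-1) ^+ n * (x%:~R * ((q n)%:R * alpha - p0%:~R)
    - y%:~R * ((q n.+1)%:R * alpha - p1%:~R))); first by ring.
  rewrite h1 h2 exprS; have := sqrr_sign R n; rewrite expr2 => s2.
  transitivity ((-1) ^+ n * (-1) ^+ n * (x%:~R * e n.+1 + y%:~R * e n.+2)); first by ring.
  by rewrite s2 mul1r.
rewrite hz.
have e1 := cf_err_gt0 n.+1; have e2 := cf_err_gt0 n.+2.
have q0 := cf_den_gt0 n.
(* For x and y of opposite signs, the two terms of [hk] add up in absolute value. *)
have far : [\/ x = 0, 1 <= x /\ y <= -1 | x <= -1 /\ 1 <= y] ->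
    k%:Z = 0 \/ (q n.+1)%:Z <= k%:Z.
  have q1 := cf_den_gt0 n.+1.
  have -> : k%:Z = `|x * (q n)%:Z - y * (q n.+1)%:Z|.
    by have := congr1 Num.norm hk; rewrite normrM normrX normrN1 expr1n mul1r => <-.
  case=> [->|[x1 y1]|[x1 y1]].
  - rewrite mul0r sub0r normrN normrM; have [->|y1] := eqVneq y 0; first by left; rewrite normr0 mul0r.
    by right; rewrite [leRHS]mulrC ler_peMr // -gtz0_ge1 normr_gt0.
  - right; apply: le_trans (ler_norm _); nia.
  - right; rewrite -normrN; apply: le_trans (ler_norm _); nia.
have [s|[s|s]] : [\/ x = 0, 1 <= x /\ y <= -1 | x <= -1 /\ 1 <= y] \/
    ((1 <= x /\ 0 <= y) \/ (x <= -1 /\ y <= 0)).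
- have [x0|[x0|x0]] : x = 0 \/ 1 <= x \/ x <= -1 by lia.
  + by left; constructor 1.
  + have [y0|y0] : 0 <= y \/ y <= -1 by lia.
      by right; left.
    by left; constructor 2.
  + have [y0|y0] : y <= 0 \/ 1 <= y by lia.
      by right; right.
    by left; constructor 3.
- by have := far s; lia.
- case: s; rewrite -(ler_int R) -(ler_int R 0) => x1 y0.
  rewrite ger0_norm; nra.
- case: s; rewrite -(ler_int R) -(ler_int R _ 0) => x1 y0.
  rewrite ler0_norm; nra.
Qed.

Lemma dist_int_ge_den n (k : nat) :
  (0 < k < q n)%N -> 1 <= 2 * (q n)%:R * dist_int (k%:R * alpha).
Proof.
case: n => [|n]; first by rewrite cf_den0; case: k.
move=> kq; apply: le_trans (cf_err_ge n) _.
by rewrite ler_wpM2l ?mulr_ge0 // best_approx.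
Qed.

Lemma dist_int_irr_gt0 (k : int) : k != 0 -> 0 < dist_int (k%:~R * alpha).
Proof.
move=> k0; have [m [-> _]] := dist_int_round (k%:~R * alpha).
by rewrite normr_gt0 subr_eq0 irrational_neq_ratio.
Qed.

End continued_fraction.

(** * Sums over blocks of the orbit *)

Section counting.
Variable R : realType.

Lemma le_of_eq (x y : R) : x = y -> x <= y.
Proof. by move=> ->. Qed.

Lemma sum_inj_le (I J : finType) (A : pred I) (f : I -> J) (F : I -> R) (G : J -> R) :
  {in A &, injective f} -> (forall i, A i -> F i <= G (f i)) -> (forall j, 0 <= G j) ->
  \sum_(i | A i) F i <= \sum_j G j.
Proof.
move=> fI FG G0; apply: (le_trans (y := \sum_(i in A) G (f i))).
  by apply: ler_sum => i Ai; exact: FG.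
rewrite -big_imset //= [leRHS](bigID (mem [set f x | x in A]%SET)) /= lerDl.
by apply: sumr_ge0.
Qed.

(** Comparison with the telescoping sum of 1 / (i - 1 + k) - 1 / (i + k). *)
Lemma sum_inv_sq_le (k : R) (M : nat) : 0 < k ->
  \sum_(i < M) (i%:R + k) ^- 2 <= k ^- 2 + k^-1.
Proof.
move=> k0.
suff : \sum_(i < M.+1) (i%:R + k) ^- 2 <= k ^- 2 + k^-1 - (M%:R + k)^-1.
  rewrite big_ord_recr /=; have : 0 <= (M%:R + k) ^- 2 by rewrite invr_ge0 sqr_ge0.
  have : 0 <= (M%:R + k)^-1 by rewrite invr_ge0 addr_ge0 // ltW.
  lra.
elim: M => [|M IH]; first by rewrite big_ord1 add0r addrK.
rewrite big_ord_recr /=; apply: le_trans (lerD IH (lexx _)) _.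
set x := M%:R + k; have x0 : 0 < x by rewrite ltr_wpDl.
have -> : M.+1%:R + k = x + 1 by rewrite /x -natr1; ring.
have x1 : 0 < x + 1 by lra.
suff : (x + 1) ^- 2 <= x^-1 - (x + 1)^-1 by lra.
have -> : x^-1 - (x + 1)^-1 = (x * (x + 1))^-1 by field; rewrite !gt_eqF.
rewrite lef_pV2 ?posrE ?exprn_gt0 ?mulr_gt0 //; nra.
Qed.

(** The q points are 1 / (2 q)-separated modulo 1.  Hence on each side of the
integers at most one of them has its distance in a given bin
[i / (2 q), (i + 1) / (2 q)), and the sum is at most twice the sum over the
left ends of the bins. *)
Lemma block_sum_le (alpha : R) (q c : nat) (eps : R) :
  (0 < q)%N -> 0 < eps ->
  (forall k : nat, (0 < k < q)%N -> 1 <= 2 * q%:R * dist_int (k%:R * alpha)) ->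
  \sum_(n < q) (dist_int ((c + n)%:R * alpha) + eps) ^- 2 <= 2 * eps ^- 2 + 4 * q%:R / eps.
Proof.
move=> q0 eps0 sep.
have Q0 : 0 < q%:R :> R by rewrite ltr0n.
pose u (n : 'I_q) : R := (c + n)%:R * alpha.
pose m (n : 'I_q) : int := sval (cid (dist_int_round (u n))).
have mP n : dist_int (u n) = `|u n - (m n)%:~R| by rewrite /m; case: cid => k [].
pose P (n : 'I_q) := 0 <= u n - (m n)%:~R.
(* P n is the side of the nearest integer, f n the bin of the distance. *)
pose f (n : 'I_q) : 'I_q.+1 := inord (Num.truncn (2 * q%:R * dist_int (u n))).
have d0 n : 0 <= 2 * q%:R * dist_int (u n) by rewrite !mulr_ge0 // dist_int_ge0.
have fE n : f n = Num.truncn (2 * q%:R * dist_int (u n)) :> nat.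
  rewrite inordK // ltnS truncn_le_nat -natr1.
  have := dist_int_le_half (u n); nra.
have fI (b : bool) : {in [pred n | P n == b] &, injective f}.
  move=> i j; rewrite !inE => Pi Pj fij; apply/val_inj/eqP; apply: contraT => nij.
  have : dist_int (u i - u j) < (2 * q%:R)^-1.
    apply: (le_lt_trans (y := `|dist_int (u i) - dist_int (u j)|)).
      apply: le_trans (dist_int_le _ (m i - m j)) _; rewrite intrB !mP.
      move: Pi Pj; case: b; rewrite /P ?eqb_id ?eqbF_neg -?ltNge.
        by move=> h1 h2; rewrite [`|u i - _|]ger0_norm // [`|u j - _|]ger0_norm //;
          apply: le_of_eq; congr (Num.norm _); ring.
      move=> h1 h2; rewrite [`|u i - _|]ltr0_norm // [`|u j - _|]ltr0_norm //.
      by rewrite -normrN; apply: le_of_eq; congr (Num.norm _); ring.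
    have h : (f i : nat) = f j by rewrite fij.
    rewrite !fE in h.
    have /andP[i1 i2] := truncn_itv (d0 i); have /andP[j1 j2] := truncn_itv (d0 j).
    rewrite h -natr1 in i1 i2; rewrite -natr1 in j2.
    rewrite -(ltr_pM2l (x := 2 * q%:R)) ?mulr_gt0 // divff ?gt_eqF ?mulr_gt0 //.
    rewrite -{1}(ger0_norm (x := 2 * q%:R)) ?mulr_ge0 // -normrM mulrBr ltr_norml; lra.
  wlog ij : i j {Pi Pj fij} nij / (j < i)%N.
    move=> H; have [h|h|/val_inj h] := ltngtP (val i) (val j).
    - by rewrite -dist_intN opprB; apply: H; rewrite // eq_sym.
    - exact: H.
    - by rewrite h eqxx in nij.
  have := sep (i - j)%N; rewrite subn_gt0 ij /= => /(_ (leq_ltn_trans (leq_subr _ _) (ltn_ord i))).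
  have -> : u i - u j = (i - j)%:R * alpha by rewrite natrB ?(ltnW ij) // /u !natrD; ring.
  move=> h1; rewrite -(ltr_pM2l (x := 2 * q%:R)) ?mulr_gt0 // divff ?gt_eqF ?mulr_gt0 //.
  by rewrite ltNge h1.
pose G (j : 'I_q.+1) := 4 * q%:R ^+ 2 * (j%:R + 2 * q%:R * eps) ^- 2 : R.
have G0 j : 0 <= G j by rewrite mulr_ge0 ?mulr_ge0 ?exprn_ge0 // invr_ge0 sqr_ge0.
have FG n : (dist_int (u n) + eps) ^- 2 <= G (f n).
  have -> : G (f n) = ((f n : nat)%:R / (2 * q%:R) + eps) ^- 2.
    rewrite /G; field; rewrite !gt_eqF //=;
      have := mulr_gt0 Q0 eps0; have : 0 <= (f n : nat)%:R :> R by []; lra.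
  have h : (f n : nat)%:R / (2 * q%:R) <= dist_int (u n).
    rewrite fE ler_pdivrMr ?mulr_gt0 // [leRHS]mulrC.
    by have /andP[h _] := truncn_itv (d0 n).
  have h' : 0 <= (f n : nat)%:R / (2 * q%:R) :> R by rewrite divr_ge0 // mulr_ge0.
  have p1 : 0 < (f n : nat)%:R / (2 * q%:R) + eps by rewrite ltr_wpDl.
  have p2 : 0 < dist_int (u n) + eps by rewrite ltr_wpDl // dist_int_ge0.
  by rewrite lef_pV2 ?posrE ?exprn_gt0 // lerXn2r ?nnegrE ?(ltW p1) ?(ltW p2) // lerD2r.
have GS : \sum_j G j <= eps ^- 2 + 2 * q%:R / eps.
  rewrite /G -mulr_sumr.
  have k0 : 0 < 2 * q%:R * eps by rewrite !mulr_gt0.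
  apply: le_trans (ler_wpM2l _ (sum_inv_sq_le q.+1 k0)) _; first by rewrite mulr_ge0 ?exprn_ge0.
  by apply: le_of_eq; field; rewrite !gt_eqF.
rewrite (bigID (fun n : 'I_q => P n == true)) /=.
have S1 := sum_inj_le (fI true) (fun n _ => FG n) G0.
have S2 := sum_inj_le (fI false) (fun n _ => FG n) G0.
rewrite [X in _ + X](eq_bigl (fun n => P n == false)); last by move=> n; case: (P n).
apply: le_trans (lerD S1 S2) _; lra.
Qed.

End counting.

(** * Elementary estimates for the three ranges of indices *)

Section sums.
Variable R : realType.

Lemma sum_blocks (F : nat -> R) (q A : nat) :
  \sum_(q <= n < A.+1 * q) F n = \sum_(l < A) \sum_(i < q) F (l.+1 * q + i)%N.
Proof.
elim: A => [|A IH]; first by rewrite mul1n big_ord0 big_geq.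
rewrite big_ord_recr /= -IH [in LHS](big_cat_nat (n := A.+1 * q)) /=; last 2 first.
- by rewrite leq_pmull.
- by rewrite leq_mul2r leqnSn orbT.
congr (_ + _); rewrite -[X in index_iota X _]add0n (mulSn A.+1) big_addn addnK big_mkord.
by apply: eq_bigr => i _; rewrite addnC.
Qed.

Lemma ler_sum_nat_widen (F : nat -> R) (a b c : nat) :
  (b <= c)%N -> (forall n, 0 <= F n) -> \sum_(a <= n < b) F n <= \sum_(a <= n < c) F n.
Proof.
move=> bc F0; have [ab|ba] := leqP a b; last by rewrite big_geq ?(ltnW ba) // sumr_ge0.
by rewrite [leRHS](big_cat_nat ab bc) /= lerDl sumr_ge0.
Qed.

Lemma sum_sqr_le (I : Type) (r : seq I) (P : pred I) (F : I -> R) : (forall i, 0 <= F i) ->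
  \sum_(i <- r | P i) F i ^+ 2 <= (\sum_(i <- r | P i) F i) ^+ 2.
Proof.
move=> F0; suff : 0 <= \sum_(i <- r | P i) F i /\
  \sum_(i <- r | P i) F i ^+ 2 <= (\sum_(i <- r | P i) F i) ^+ 2 by case.
elim/big_rec2 : _ => [|i x y Pi [x0 xy]]; first by rewrite expr0n.
have := F0 i; split; nra.
Qed.

Lemma expr4_add3_le (u v w : R) :
  (u + v + w) ^+ 4 <= 27 * (u ^+ 4 + v ^+ 4 + w ^+ 4).
Proof.
have H (x y z : R) : (x + y + z) ^+ 2 <= 3 * (x ^+ 2 + y ^+ 2 + z ^+ 2).
  have := sqr_ge0 (x - y); have := sqr_ge0 (x - z); have := sqr_ge0 (y - z); nra.
have h1 := H u v w; have h2 := H (u ^+ 2) (v ^+ 2) (w ^+ 2).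
rewrite -!exprM /= in h2.
have -> : (u + v + w) ^+ 4 = ((u + v + w) ^+ 2) ^+ 2 by rewrite -exprM.
apply: (le_trans (y := (3 * (u ^+ 2 + v ^+ 2 + w ^+ 2)) ^+ 2)); last by nra.
by rewrite lerXn2r ?nnegrE ?sqr_ge0 // (le_trans _ h1) ?sqr_ge0.
Qed.

Lemma sum_ord_split3 (F : nat -> R) (m N : nat) : (m < N)%N ->
  \sum_(j < N) F j = \sum_(j < N | (j < m)%N) F j + F m + \sum_(j < N | (m < j)%N) F j.
Proof.
move=> mN; rewrite (bigD1 (Ordinal mN)) //= (bigID (fun j : 'I_N => (j < m)%N)) /=.
rewrite addrA [F m + _]addrC; congr (_ + _ + _); apply: eq_bigl => j.
  by rewrite -val_eqE /=; case: ltngtP.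
by rewrite -val_eqE /=; case: ltngtP.
Qed.

Lemma sum_ord_cond_le (F : nat -> R) (M j : nat) : (forall n, 0 <= F n) ->
  \sum_(m < M | (m < j)%N) F m <= \sum_(m < j) F m.
Proof.
move=> F0; elim: M => [|M IH]; first by rewrite big_ord0 sumr_ge0.
have [Mj|jM] := leqP M.+1 j.
  rewrite (eq_bigl xpredT); last by move=> i; apply: leq_trans Mj; exact: ltn_ord.
  rewrite (big_ord_widen j F Mj) [leRHS](bigID (fun i : 'I_j => (i < M.+1)%N)) /=.
  by rewrite lerDl sumr_ge0.
rewrite big_mkcond big_ord_recr /= ltnNge -ltnS jM addr0.
by rewrite -big_mkcond.
Qed.

End sums.

Section pointwise.
Variable R : realType.
Implicit Types S X d n eta q eps : R.

(** For the indices j < m: the bound S X on || n beta || is capped at 1, and the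
resulting quotient decreases like 1 / X^2 only beyond X = 1 / S. *)
Lemma min_part_le S X : 0 < S -> 0 < X ->
  Num.min 1 (S * X) ^+ 4 / X ^+ 2 <= 4 * (X + S^-1) ^- 2.
Proof.
move=> S0 X0.
have y0 : 0 < S * X by rewrite mulr_gt0.
have -> : X + S^-1 = (1 + S * X) / S by field; rewrite gt_eqF.
have p0 : 0 < 1 + S * X by lra.
rewrite ler_pdivrMr ?exprn_gt0 //.
have -> : 4 * ((1 + S * X) / S) ^- 2 * X ^+ 2 = 4 * (S * X) ^+ 2 / (1 + S * X) ^+ 2.
  by field; rewrite !gt_eqF.
rewrite ler_pdivlMr ?exprn_gt0 //.
move: (S * X) y0 p0 => y y0 p0.
rewrite minEle; case: ifPn => [y1|]; first by rewrite expr1n; nra.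
rewrite -ltNge => y1.
apply: (le_trans (y := y ^+ 2 * 4)); last by rewrite mulrC.
apply: ler_pM; rewrite ?exprn_ge0 ?(ltW y0) ?(ltW p0) //; last by nra.
by rewrite (exprD y 2 2) ler_piMr ?sqr_ge0 //; nra.
Qed.

(** For the index j = m.  If X >= 1 / (2 q) the bound n eta suffices; for the
smaller X, the product of the two bounds on d makes the factor X cancel.
Both cases fit the same majorant, to which [block_sum_le] applies. *)
Lemma mid_part_le d n X eta q : 0 <= d -> 0 < n -> 0 < X -> 0 <= eta -> 0 < q ->
  d <= n * eta -> d <= q * X -> n * eta <= 1 ->
  d ^+ 4 / (n ^+ 2 * X ^+ 2) <= 4 * eta ^+ 2 * (X + (2 * q)^-1) ^- 2.
Proof.
move=> d0 n0 X0 eta0 q0 d1 d2 ne1.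
set eps := (2 * q)^-1.
have eps0 : 0 < eps by rewrite invr_gt0 mulr_gt0.
have qe : q * eps = 1/2 by rewrite /eps; field; rewrite gt_eqF.
rewrite ler_pdivrMr ?mulr_gt0 ?exprn_gt0 //.
rewrite mulrAC ler_pdivlMr ?exprn_gt0 ?addr_gt0 //.
have s1 : d ^+ 2 <= (n * eta) ^+ 2 by rewrite lerXn2r ?nnegrE ?mulr_ge0 ?(ltW n0) ?(ltW q0) ?(ltW X0).
rewrite (exprD d 2 2).
have [Xe|eX] := leP eps X.
  have s2 : d ^+ 2 <= 1.
    by apply: le_trans s1 _; rewrite expr_le1 // mulr_ge0 // ltW.
  have s3 : (X + eps) ^+ 2 <= 4 * X ^+ 2 by nra.
  apply: (le_trans (y := (n * eta) ^+ 2 * 1 * (4 * X ^+ 2))); last by apply: le_of_eq; ring.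
  apply: ler_pM; [by rewrite mulr_ge0 ?sqr_ge0|exact: sqr_ge0| |exact: s3].
  by apply: ler_pM; rewrite ?sqr_ge0.
have s2 : d ^+ 2 <= (q * X) ^+ 2 by rewrite lerXn2r ?nnegrE ?mulr_ge0 ?(ltW n0) ?(ltW q0) ?(ltW X0).
have s3 : (q * (X + eps)) ^+ 2 <= 1.
  have h : q * (X + eps) <= 1 by rewrite mulrDr qe; have := ltr_pM2l q0 X eps; rewrite eX qe; lra.
  by rewrite expr_le1 // mulr_ge0 // ltW // addr_gt0.
apply: (le_trans (y := (n * eta) ^+ 2 * (q * X) ^+ 2 * (X + eps) ^+ 2)).
  by rewrite ler_wpM2r ?sqr_ge0 //; apply: ler_pM; rewrite ?sqr_ge0.
rewrite (_ : _ * _ = (n * eta * X) ^+ 2 * (q * (X + eps)) ^+ 2); last by ring.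
rewrite (_ : 4 * _ * _ = (n * eta * X) ^+ 2 * 4); last by ring.
by rewrite ler_wpM2l ?sqr_ge0 //; lra.
Qed.

(** For the indices j > m, where X >= 1 / (2 Q) holds for all n < Q. *)
Lemma far_part_le n X W Q : 0 < n -> 0 < X -> 0 <= W -> 0 < Q -> n <= Q -> (2 * Q)^-1 <= X ->
  (n * W) ^+ 4 / (n ^+ 2 * X ^+ 2) <= 4 * Q ^+ 2 * W ^+ 4 * (X + (2 * Q)^-1) ^- 2.
Proof.
move=> n0 X0 W0 Q0 nQ XQ; set eps := (2 * Q)^-1 in XQ *.
have eps0 : 0 < eps by rewrite invr_gt0 mulr_gt0.
have -> : (n * W) ^+ 4 / (n ^+ 2 * X ^+ 2) = n ^+ 2 * W ^+ 4 / X ^+ 2.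
  by field; rewrite !gt_eqF.
rewrite ler_pdivrMr ?exprn_gt0 // [leRHS]mulrAC ler_pdivlMr ?exprn_gt0 ?addr_gt0 //.
rewrite (_ : 4 * _ * _ * _ = Q ^+ 2 * W ^+ 4 * (4 * X ^+ 2)); last by ring.
apply: ler_pM; [by rewrite mulr_ge0 ?exprn_ge0 ?(ltW n0)|exact: sqr_ge0| |by nra].
by rewrite ler_wpM2r ?exprn_ge0 // lerXn2r ?nnegrE ?(ltW n0) ?(ltW Q0).
Qed.

End pointwise.

(** * The energy of a finite sum of multiples of q_j alpha *)

Arguments cf_den : simpl never.

Section cf_sums.
Variables (R : realType) (alpha : R).
Hypotheses (alpha01 : 0 < alpha < 1) (alpha_irr : irrational alpha).
Local Notation q := (cf_den alpha).
Local Notation a := (cf_digit alpha).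

Let q0 m : 0 < (q m)%:R :> R. Proof. by rewrite ltr0n cf_den_gt0. Qed.

Lemma cf_den_double m : 2 * (q m)%:R <= (q m.+2)%:R :> R.
Proof.
apply: (le_trans (y := (q m + q m.+1)%:R)); last by rewrite ler_nat cf_den_addS.
by rewrite natrD mulr2n mulrDl !mul1r lerD2l ler_nat cf_den_leS.
Qed.

(** The q_m double every second step, so that 1 / q_m is at most the decrement of
2 / q_m + 2 / q_{m+1}. *)
Lemma sum_inv_den_le (M j : nat) :
  \sum_(m < M | (j < m)%N) (q m)%:R^-1 <= 4 / (q j.+1)%:R :> R.
Proof.
pose t m : R := 2 / (q m)%:R + 2 / (q m.+1)%:R.
have t0 m : 0 <= t m by rewrite addr_ge0 // divr_ge0.
have tS m : (q m)%:R^-1 + t m.+1 <= t m.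
  have : (q m.+2)%:R^-1 <= (q m)%:R^-1 / 2 :> R.
    by rewrite -invfM lef_pV2 ?posrE ?mulr_gt0 // mulrC cf_den_double.
  rewrite /t; lra.
have H : \sum_(m < M | (j < m)%N) (q m)%:R^-1 + t (maxn M j.+1) <= t j.+1.
  elim: M => [|M IH]; first by rewrite big_ord0 add0r max0n.
  rewrite big_mkcond big_ord_recr /= -big_mkcond.
  have [jM|Mj] := ltnP j M.
    move: IH; rewrite (maxn_idPl jM) (maxn_idPl (ltnW jM : (j.+1 <= M.+1)%N)) => IH.
    have := tS M; lra.
  move: IH; rewrite (maxn_idPr (leqW Mj)) maxnSS (maxn_idPr Mj); lra.
have : t j.+1 <= 4 / (q j.+1)%:R.
  have : (q j.+2)%:R^-1 <= (q j.+1)%:R^-1 :> R by rewrite lef_pV2 ?posrE // ler_nat cf_den_leS.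
  rewrite /t; lra.
have := t0 (maxn M j.+1); lra.
Qed.

Lemma sum_den_le (j : nat) : \sum_(m < j) (q m.+1)%:R <= 3 * (q j)%:R :> R.
Proof.
case: j => [|j]; first by rewrite big_ord0 mulr_ge0.
have : \sum_(m < j.+1) (q m.+1)%:R <= 2 * (q j.+1)%:R + (q j)%:R :> R.
  elim: j => [|j IH]; first by rewrite big_ord1 /=; have := q0 0; have := q0 1; lra.
  rewrite big_ord_recr /=.
  have : (q j)%:R + (q j.+1)%:R <= (q j.+2)%:R :> R by rewrite -natrD ler_nat cf_den_addS.
  lra.
have : (q j)%:R <= (q j.+1)%:R :> R by rewrite ler_nat cf_den_leS.
lra.
Qed.

Lemma den_ratio_le j : (q j)%:R / (q j.+1)%:R <= (a j.+1)%:R^-1 :> R.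
Proof.
have a0 : 0 < (a j.+1)%:R :> R by rewrite ltr0n cf_digit_gt0.
by rewrite ler_pdivrMr // ler_pdivlMl // -natrM ler_nat cf_digit_mul_le.
Qed.

Lemma den_err_le j : (q j)%:R * cf_err alpha j.+1 <= (a j.+1)%:R^-1.
Proof.
apply: le_trans (den_ratio_le j); rewrite ler_wpM2l //.
by rewrite -[leRHS]mul1r ler_pdivlMr // mulrC cf_err_le.
Qed.

End cf_sums.

Section energy.
Variables (R : realType) (alpha : R).
Hypotheses (alpha01 : 0 < alpha < 1) (alpha_irr : irrational alpha).
Local Notation q := (cf_den alpha).
Local Notation a := (cf_digit alpha).
Local Notation e := (cf_err alpha).
Local Notation X n := (dist_int (n%:R * alpha)).

Variables (beta : R) (B : nat -> R) (N : nat).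
Hypothesis B0 : forall j, 0 <= B j.
Hypothesis B4 : forall j, B j <= B j ^+ 4.
Hypothesis hb : forall n : nat, dist_int (n%:R * beta) <=
  \sum_(j < N) B j * dist_int (n%:R * ((q j)%:R * alpha)).

Let S m := \sum_(j < N | (j < m)%N) B j * (q j)%:R.
Let W m := \sum_(j < N | (m < j)%N) B j * e j.+1.

Let q0 m : 0 < (q m)%:R :> R. Proof. by rewrite ltr0n cf_den_gt0. Qed.
Let a0 m : 0 < (a m.+1)%:R :> R. Proof. by rewrite ltr0n cf_digit_gt0. Qed.
Let e0 m : 0 < e m. Proof. exact: cf_err_gt0. Qed.
Let S0 m : 0 <= S m. Proof. by apply: sumr_ge0 => j _; rewrite mulr_ge0. Qed.
Let W0 m : 0 <= W m. Proof. by apply: sumr_ge0 => j _; rewrite mulr_ge0 // ltW. Qed.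
Let X0 (n : nat) : (0 < n)%N -> 0 < X n.
Proof. by move=> n0; rewrite -[n%:R]/(n%:~R) dist_int_irr_gt0 // -lt0n. Qed.

(** The cap at 1 is attached to the first part only: where it is active, the bound
|| n beta || <= 1 replaces the expansion of beta. *)
Lemma dist_three_le m (n : nat) : (m < N)%N ->
  dist_int (n%:R * beta) <= Num.min 1 (S m * X n)
    + B m * dist_int (n%:R * ((q m)%:R * alpha)) + n%:R * W m.
Proof.
move=> mN.
have h := hb n.
rewrite (sum_ord_split3 (fun j => B j * dist_int (n%:R * ((q j)%:R * alpha))) mN) in h.
have h1 : \sum_(j < N | (j < m)%N) B j * dist_int (n%:R * ((q j)%:R * alpha)) <= S m * X n.
  rewrite /S mulr_suml; apply: ler_sum => j _; rewrite -[leRHS]mulrA ler_wpM2l //.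
  by rewrite mulrCA dist_intMn.
have h2 : \sum_(j < N | (m < j)%N) B j * dist_int (n%:R * ((q j)%:R * alpha)) <= n%:R * W m.
  rewrite /W mulr_sumr; apply: ler_sum => j _; rewrite [leRHS]mulrCA ler_wpM2l //.
  by apply: le_trans (dist_intMn _ _) _; rewrite ler_wpM2l // dist_int_den.
have h3 : 0 <= B m * dist_int (n%:R * ((q m)%:R * alpha)) by rewrite mulr_ge0 // dist_int_ge0.
have h4 : 0 <= n%:R * W m by rewrite mulr_ge0.
have h5 := dist_int_le1 (n%:R * beta).
rewrite minEle; case: ifP => _; lra.
Qed.

Lemma sum_blocks_inv_le m (eps : R) (C : nat -> R) : 0 < eps ->
  (forall l, 0 <= C l) ->
  \sum_(l < a m.+1) \sum_(i < q m) C l * (X (l.+1 * q m + i)%N + eps) ^- 2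
    <= (\sum_(l < a m.+1) C l) * (2 * eps ^- 2 + 4 * (q m)%:R / eps).
Proof.
move=> eps0 C0; rewrite mulr_suml; apply: ler_sum => l _.
rewrite -mulr_sumr ler_wpM2l //; apply: block_sum_le => //; first exact: cf_den_gt0.
by move=> k; exact: dist_int_ge_den.
Qed.

Lemma near_level_le m :
  \sum_(q m <= n < q m.+1) Num.min 1 (S m * X n) ^+ 4 / (n%:R ^+ 2 * X n ^+ 2)
  <= 16 * (S m / (q m)%:R) ^+ 2 + 32 * (S m / (q m)%:R).
Proof.
have F0 n : 0 <= Num.min 1 (S m * X n) ^+ 4 / (n%:R ^+ 2 * X n ^+ 2).
  by apply: divr_ge0; [exact: exprn_even_ge0|rewrite mulr_ge0 ?sqr_ge0].
have sq0 : 0 <= S m / (q m)%:R by rewrite divr_ge0.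
have [Sz|Sp] : S m = 0 \/ 0 < S m.
  by have := S0 m; rewrite le_eqVlt => /predU1P[<-|]; [left|right].
  rewrite big1 ?addr_ge0 ?mulr_ge0 ?sqr_ge0 // => n _.
  by rewrite Sz mul0r minEle ler10 expr0n mul0r.
apply: le_trans (ler_sum_nat_widen (c := ((a m.+1).+1 * q m)%N) _ _ F0) _.
  exact: cf_den_le_mul.
rewrite (sum_blocks (fun n => Num.min 1 (S m * X n) ^+ 4 / (n%:R ^+ 2 * X n ^+ 2))).
pose C (l : nat) : R := 4 * (l.+1%:R * (q m)%:R) ^- 2.
have C0 l : 0 <= C l by rewrite mulr_ge0 // invr_ge0 sqr_ge0.
have Si0 : 0 < (S m)^-1 by rewrite invr_gt0.
apply: (le_trans (y := \sum_(l < a m.+1) \sum_(i < q m) C l * (X (l.+1 * q m + i)%N + (S m)^-1) ^- 2)).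
  apply: ler_sum => l _; apply: ler_sum => i _.
  set n := (l.+1 * q m + i)%N.
  have nl : (l.+1 * q m <= n)%N by rewrite leq_addr.
  have n0 : (0 < n)%N by apply: leq_trans nl; rewrite muln_gt0 /= cf_den_gt0.
  have := min_part_le Sp (X0 n0).
  move: (Num.min 1 _) => v h.
  have n0' : 0 < n%:R :> R by rewrite ltr0n.
  have -> : v ^+ 4 / (n%:R ^+ 2 * X n ^+ 2) = n%:R ^- 2 * (v ^+ 4 / X n ^+ 2).
    by field; rewrite (gt_eqF n0') gt_eqF // X0.
  have -> : C l * (X n + (S m)^-1) ^- 2 = (l.+1%:R * (q m)%:R) ^- 2 * (4 * (X n + (S m)^-1) ^- 2).
    by rewrite /C mulrCA mulrA.
  apply: ler_pM => //; rewrite ?invr_ge0 ?sqr_ge0 //.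
    by apply: divr_ge0; [exact: exprn_even_ge0|exact: sqr_ge0].
  by rewrite lef_pV2 ?posrE ?exprn_gt0 ?mulr_gt0 // -natrM lerXn2r ?nnegrE // ler_nat.
apply: le_trans (sum_blocks_inv_le _ Si0 C0) _.
have CS : \sum_(l < a m.+1) C l <= 8 * (q m)%:R ^- 2.
  have -> : \sum_(l < a m.+1) C l = 4 * (q m)%:R ^- 2 * \sum_(l < a m.+1) (l%:R + 1) ^- 2.
    rewrite mulr_sumr; apply: eq_bigr => l _; rewrite /C -natr1.
    have l0 : 0 < l%:R + 1 :> R by rewrite ltr_wpDl.
    by field; rewrite !gt_eqF.
  have := sum_inv_sq_le (a m.+1) (@ltr01 R); rewrite expr1n invr1 => h.
  have : 0 <= (q m)%:R ^- 2 :> R by rewrite invr_ge0 sqr_ge0.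
  nra.
apply: le_trans (ler_wpM2r _ CS) _.
  by rewrite addr_ge0 ?mulr_ge0 ?divr_ge0 // ?invr_ge0 ?exprn_ge0 // ltW.
by apply: le_of_eq; field; rewrite !gt_eqF.
Qed.

(** There are a_{m+1} blocks, and each contributes
O (B_m^4 ||q_m alpha||^2 q_m^2) = O (B_m^4 / a_{m+1}^2). *)
Lemma mid_level_le m :
  \sum_(q m <= n < q m.+1)
    (B m * dist_int (n%:R * ((q m)%:R * alpha))) ^+ 4 / (n%:R ^+ 2 * X n ^+ 2)
  <= 64 * (B m ^+ 4 / (a m.+1)%:R).
Proof.
pose F (n : nat) : R := 4 * B m ^+ 4 * e m.+1 ^+ 2 * (X n + (2 * (q m)%:R)^-1) ^- 2.
have F0 n : 0 <= F n.
  by rewrite /F !mulr_ge0 ?exprn_ge0 // ?(ltW (e0 _)) // invr_ge0 sqr_ge0.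
apply: (le_trans (y := \sum_(q m <= n < q m.+1) F n)).
  rewrite !big_nat; apply: ler_sum => n /andP[n1 n2].
  have n0 : (0 < n)%N by apply: leq_trans n1; exact: cf_den_gt0.
  have d1 : dist_int (n%:R * ((q m)%:R * alpha)) <= n%:R * e m.+1.
    by apply: le_trans (dist_intMn _ _) _; rewrite ler_wpM2l // dist_int_den.
  have d2 : dist_int (n%:R * ((q m)%:R * alpha)) <= (q m)%:R * X n by rewrite mulrCA dist_intMn.
  have d3 : n%:R * e m.+1 <= 1.
    by apply: le_trans (cf_err_le alpha01 alpha_irr m); rewrite ler_wpM2r ?(ltW (e0 _)) // ler_nat ltnW.
  have n0' : 0 < n%:R :> R by rewrite ltr0n.
  have := mid_part_le (dist_int_ge0 _) n0' (X0 n0) (ltW (e0 _)) (q0 m) d1 d2 d3.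
  move=> h; rewrite exprMn -mulrA /F.
  rewrite (_ : 4 * _ * _ * _ = B m ^+ 4 * (4 * e m.+1 ^+ 2 * (X n + (2 * (q m)%:R)^-1) ^- 2)); last by ring.
  by rewrite ler_wpM2l // exprn_ge0.
apply: le_trans (ler_sum_nat_widen (c := ((a m.+1).+1 * q m)%N) _ _ F0) _.
  exact: cf_den_le_mul.
rewrite (sum_blocks F) /F.
have ep : 0 < (2 * (q m)%:R)^-1 :> R by rewrite invr_gt0 mulr_gt0.
apply: le_trans (sum_blocks_inv_le _ ep (C := fun=> 4 * B m ^+ 4 * e m.+1 ^+ 2) _) _.
  by move=> _; rewrite !mulr_ge0 ?exprn_ge0 // ltW.
rewrite sumr_const card_ord -mulr_natl.
have h : ((q m)%:R * e m.+1) ^+ 2 <= (a m.+1)%:R ^- 2.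
  by rewrite -exprVn lerXn2r ?nnegrE ?invr_ge0 ?(ltW (a0 _)) ?mulr_ge0 ?(ltW (e0 _)) ?(ltW (q0 _)) // den_err_le.
apply: (le_trans (y := 64 * (a m.+1)%:R * B m ^+ 4 * ((q m)%:R * e m.+1) ^+ 2)).
  by apply: le_of_eq; field; rewrite gt_eqF.
apply: le_trans (ler_wpM2l _ h) _; first by rewrite !mulr_ge0 ?exprn_ge0.
by apply: le_of_eq; field; rewrite gt_eqF.
Qed.

Lemma far_level_le m :
  \sum_(q m <= n < q m.+1) (n%:R * W m) ^+ 4 / (n%:R ^+ 2 * X n ^+ 2)
  <= 64 * ((q m.+1)%:R * W m) ^+ 4.
Proof.
pose Q := q m.+1.
pose F (n : nat) : R := 4 * Q%:R ^+ 2 * W m ^+ 4 * (X n + (2 * Q%:R)^-1) ^- 2.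
have Q0 : 0 < Q%:R :> R by exact: q0.
have C0 : 0 <= 4 * Q%:R ^+ 2 * W m ^+ 4 by rewrite !mulr_ge0 ?exprn_ge0.
have F0 n : 0 <= F n by rewrite /F mulr_ge0 // invr_ge0 sqr_ge0.
apply: (le_trans (y := \sum_(q m <= n < Q) F n)).
  rewrite !big_nat; apply: ler_sum => n /andP[n1 n2].
  have n0 : (0 < n)%N by apply: leq_trans n1; exact: cf_den_gt0.
  have n0' : 0 < n%:R :> R by rewrite ltr0n.
  apply: far_part_le => //; first exact: X0.
    by rewrite ler_nat ltnW.
  have nQ : (0 < n < Q)%N by rewrite n0.
  have := dist_int_ge_den alpha01 alpha_irr nQ => h.
  by rewrite -[leLHS]mul1r ler_pdivrMr ?mulr_gt0 // mulrC.
apply: (le_trans (y := \sum_(0 <= n < Q) F n)).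
  rewrite [leRHS](big_cat_nat (n := q m)) //=; last exact: cf_den_leS.
  by rewrite lerDr sumr_ge0.
rewrite big_mkord /F -mulr_sumr.
have ep : 0 < (2 * Q%:R)^-1 :> R by rewrite invr_gt0 mulr_gt0.
have := @block_sum_le R alpha Q 0 _ (cf_den_gt0 alpha01 alpha_irr _) ep
  (fun k => @dist_int_ge_den _ _ alpha01 alpha_irr m.+1 k) => h.
apply: le_trans (ler_wpM2l C0 h) _.
by apply: le_of_eq; field; rewrite gt_eqF.
Qed.


Let D n := dist_int (n%:R * beta).
Let s m := S m / (q m)%:R.
Let w m := (q m.+1)%:R * W m.
Let s0 m : 0 <= s m. Proof. by rewrite divr_ge0. Qed.
Let w0 m : 0 <= w m. Proof. by rewrite mulr_ge0. Qed.

Lemma level_le m : (m < N)%N ->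
  \sum_(q m <= n < q m.+1) D n ^+ 4 / (n%:R ^+ 2 * X n ^+ 2)
  <= 27 * (16 * s m ^+ 2 + 32 * s m + 64 * (B m ^+ 4 / (a m.+1)%:R) + 64 * w m ^+ 4).
Proof.
move=> mN.
pose F1 (n : nat) := Num.min 1 (S m * X n) ^+ 4 / (n%:R ^+ 2 * X n ^+ 2).
pose F2 (n : nat) := (B m * dist_int (n%:R * ((q m)%:R * alpha))) ^+ 4 / (n%:R ^+ 2 * X n ^+ 2).
pose F3 (n : nat) := (n%:R * W m) ^+ 4 / (n%:R ^+ 2 * X n ^+ 2).
apply: (le_trans (y := \sum_(q m <= n < q m.+1) 27 * (F1 n + F2 n + F3 n))).
  apply: ler_sum => n _; rewrite /F1 /F2 /F3 -!mulrDl [leRHS]mulrA.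
  rewrite ler_wpM2r ?invr_ge0 ?mulr_ge0 ?sqr_ge0 ?dist_int_ge0 //.
  have h := dist_three_le n mN; have d0 := dist_int_ge0 (n%:R * beta).
  apply: le_trans _ (expr4_add3_le _ _ _); rewrite lerXn2r ?nnegrE //.
  exact: le_trans d0 h.
rewrite -mulr_sumr !big_split /= ler_wpM2l //.
have h1 := near_level_le m; have h2 := mid_level_le m; have h3 := far_level_le m.
by rewrite !lerD.
Qed.

Lemma sum_near_le M : \sum_(m < M) s m <= 4 * \sum_(j < N) B j / (a j.+1)%:R.
Proof.
rewrite (eq_bigr (fun m : 'I_M => \sum_(j < N | (j < m)%N) B j * (q j)%:R / (q m)%:R)); last first.
  by move=> m _; rewrite /s /S mulr_suml.
rewrite (exchange_big_dep xpredT) //= mulr_sumr; apply: ler_sum => j _.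
rewrite -mulr_sumr; apply: le_trans (ler_wpM2l _ (sum_inv_den_le alpha01 alpha_irr M j)) _.
  by rewrite mulr_ge0.
rewrite [leLHS](_ : _ = 4 * (B j * ((q j)%:R / (q j.+1)%:R))); last by ring.
by rewrite ler_wpM2l // ler_wpM2l // den_ratio_le.
Qed.

Lemma sum_far_le M : \sum_(m < M) w m <= 3 * \sum_(j < N) B j / (a j.+1)%:R.
Proof.
rewrite (eq_bigr (fun m : 'I_M => \sum_(j < N | (m < j)%N) B j * e j.+1 * (q m.+1)%:R)); last first.
  by move=> m _; rewrite /w /W mulr_sumr; apply: eq_bigr => j _; rewrite mulrC.
rewrite (exchange_big_dep xpredT) //= mulr_sumr; apply: ler_sum => j _.
rewrite -mulr_sumr.
have h : \sum_(m < M | (m < j)%N) (q m.+1)%:R <= 3 * (q j)%:R :> R.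
  apply: le_trans (sum_den_le alpha01 alpha_irr j).
  by apply: (sum_ord_cond_le (F := fun m => (q m.+1)%:R)).
apply: le_trans (ler_wpM2l _ h) _; first by rewrite mulr_ge0 // ltW.
rewrite [leLHS](_ : _ = 3 * (B j * ((q j)%:R * e j.+1))); last by ring.
by rewrite ler_wpM2l // ler_wpM2l // den_err_le.
Qed.

(** Summation over the levels m.  The hypothesis [B4] holds for absolute values
of integers; it makes \sum B_j / a_{j+1} at most T. *)
Lemma energy_den_le (M : nat) (T : R) : (M <= N)%N ->
  \sum_(j < N) B j ^+ 4 / (a j.+1)%:R <= T ->
  \sum_(1 <= n < q M) D n ^+ 4 / (n%:R ^+ 2 * X n ^+ 2)
  <= 27 * 64 * 81 * (T + T ^+ 2 + T ^+ 4).
Proof.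
move=> MN hT.
have T1 : \sum_(j < N) B j / (a j.+1)%:R <= T.
  by apply: le_trans hT; apply: ler_sum => j _; rewrite ler_wpM2r ?invr_ge0.
have B1 : 0 <= \sum_(j < N) B j / (a j.+1)%:R by apply: sumr_ge0 => j _; rewrite divr_ge0.
have hs : 0 <= \sum_(m < M) s m <= 4 * T.
  by rewrite sumr_ge0 //= (le_trans (sum_near_le M)) // ler_wpM2l.
have hw : 0 <= \sum_(m < M) w m <= 3 * T.
  by rewrite sumr_ge0 //= (le_trans (sum_far_le M)) // ler_wpM2l.
have hs2 : \sum_(m < M) s m ^+ 2 <= (4 * T) ^+ 2.
  apply: le_trans (sum_sqr_le _ _ (fun m : 'I_M => s0 m)) _; case/andP: hs => ? ?.
  by rewrite lerXn2r ?nnegrE // mulr_ge0 //; lra.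
have hw4 : \sum_(m < M) w m ^+ 4 <= (3 * T) ^+ 4.
  have -> : \sum_(m < M) w m ^+ 4 = \sum_(m < M) (w m ^+ 2) ^+ 2.
    by apply: eq_bigr => m _; rewrite -exprM.
  apply: le_trans (sum_sqr_le _ _ (fun m : 'I_M => sqr_ge0 (w m))) _.
  rewrite (exprM _ 2 2) lerXn2r ?nnegrE ?sqr_ge0 //; first by apply: sumr_ge0 => ? _; exact: sqr_ge0.
  apply: le_trans (sum_sqr_le _ _ (fun m : 'I_M => w0 m)) _; case/andP: hw => ? ?.
  by rewrite lerXn2r ?nnegrE // mulr_ge0 //; lra.
have hm : \sum_(m < M) B m ^+ 4 / (a m.+1)%:R <= T.
  apply: le_trans hT; rewrite (big_ord_widen _ (fun m => B m ^+ 4 / (a m.+1)%:R) MN).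
  rewrite [leRHS](bigID (fun i : 'I_N => (i < M)%N)) /= lerDl.
  by apply: sumr_ge0 => j _; rewrite divr_ge0 // exprn_ge0.
have -> : \sum_(1 <= n < q M) D n ^+ 4 / (n%:R ^+ 2 * X n ^+ 2) =
    \sum_(m < M) \sum_(q m <= n < q m.+1) D n ^+ 4 / (n%:R ^+ 2 * X n ^+ 2).
  elim: M {MN hs hw hs2 hw4 hm} => [|M IH]; first by rewrite big_ord0 big_geq.
  rewrite big_ord_recr /= -IH -big_cat_nat //=; first exact: cf_den_gt0.
  exact: cf_den_leS.
apply: le_trans (ler_sum _ (fun m _ => level_le (leq_trans (ltn_ord m) MN))) _.
rewrite -mulr_sumr !big_split /= -!mulr_sumr.
case/andP: hs => s1 s2; nra.
Qed.

End energy.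

(** * From finite sums to elements of H *)

Section limits.
Variable R : realType.

Lemma cvg_dist_int0 (u : nat -> R) (x : R) (n : nat) :
  (fun N => dist_int (x - u N)) @ \oo --> (0 : R) ->
  (fun N => dist_int (n%:R * u N)) @ \oo --> dist_int (n%:R * x).
Proof.
move=> h; apply/cvgrPdist_le => e e0.
have n1 : 0 < n%:R + 1 :> R by rewrite ltr_wpDl.
move/cvgrPdist_le : h => /(_ (e / (n%:R + 1)) (divr_gt0 e0 n1)); apply: filterS => N.
rewrite sub0r normrN ger0_norm ?dist_int_ge0 // => h.
apply: le_trans (dist_int_dist _ _) _; rewrite -mulrBr.
apply: le_trans (dist_intMn _ _) _.
apply: le_trans (ler_wpM2l _ h) _ => //.
rewrite mulrCA ler_piMr ?(ltW e0) // ler_pdivrMr // mul1r; lra.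
Qed.

Lemma cvg_seq_sum (I : Type) (r : seq I) (f : I -> nat -> R) (l : I -> R) :
  (forall i, f i @ \oo --> l i) ->
  (fun N => \sum_(i <- r) f i N) @ \oo --> \sum_(i <- r) l i.
Proof.
move=> h; elim: r => [|i r IH].
  by rewrite big_nil; under eq_fun do rewrite big_nil; exact: cvg_cst.
rewrite big_cons; under eq_fun do rewrite big_cons.
by apply: cvgD; [exact: h|exact: IH].
Qed.

Lemma cvg_le_cst (f : nat -> R) (l G : R) : f @ \oo --> l -> (forall N, f N <= G) -> l <= G.
Proof.
move=> fl fG; have <- := cvg_lim (@Rhausdorff R) fl.
by apply: limr_le; [apply/cvg_ex; exists l|exact: nearW].
Qed.

Lemma bounded_sum_tail (x : nat -> R) (T : R) : (forall n, 0 <= x n) ->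
  (forall N, \sum_(j < N) x j <= T) -> forall eps, 0 < eps ->
  exists N0, forall N N', (N0 <= N <= N')%N -> \sum_(N <= j < N') x j <= eps.
Proof.
move=> x0 hT eps eps0.
pose A := range (fun N => \sum_(j < N) x j).
have hA : has_sup A by split; [exists (\sum_(j < 0) x j), 0%N|exists T => _ [N _ <-]].
have [_ [N0 _ <-] h] := sup_adherent eps0 hA.
exists N0 => N N' /andP[N0N NN'].
have h1 : \sum_(j < N') x j <= sup A by apply: ub_le_sup; [exact: hA.2|exists N'].
have h2 : \sum_(j < N0) x j <= \sum_(j < N) x j.
  by rewrite -!(big_mkord xpredT x); exact: ler_sum_nat_widen.
have : \sum_(j < N') x j = \sum_(j < N) x j + \sum_(N <= j < N') x j.
  by rewrite -!(big_mkord xpredT x) -big_cat_nat.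
lra.
Qed.

Lemma esum_int_lty (F : nat -> R) (f : int -> R) (G : R) :
  (forall n, 0 <= F n) -> (forall n : int, n != 0 -> f n = F `|n|%N) ->
  (forall K, \sum_(1 <= n < K) F n <= G) ->
  (\esum_(n in [set n : int | n != 0%R]) (f n)%:E < +oo)%E.
Proof.
move=> F0 fF hG.
have series_lty (e : nat -> int) : injective e -> (forall n, `|e n|%N = n.+1) ->
    (\esum_(n in [set e x | x in setT]) (f n)%:E < +oo)%E.
  move=> einj en.
  have en0 n : e n != 0 by rewrite -absz_eq0 en.
  rewrite esum_set_image; last 2 first.
  - by move=> n _; rewrite lee_fin fF.
  - by move=> n m _ _; exact: einj.
  apply: (@le_lt_trans _ _ G%:E); last exact: ltry.
  apply: lime_le; first by apply: is_cvg_nneseries => n _ _; rewrite lee_fin fF.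
  apply: nearW => K.
  rewrite (eq_bigl xpredT); last by move=> i; rewrite in_setT.
  rewrite sumEFin lee_fin; apply: le_trans (hG K.+1).
  rewrite big_add1 /=; apply: le_of_eq; apply: eq_bigr => i _.
  by rewrite fF // en.
rewrite (esumID [set n : int | 0 < n]); last by move=> n /= n0; rewrite lee_fin fF.
apply: lte_add_pinfty.
  rewrite (_ : _ `&` _ = [set Posz x.+1 | x in setT]); last first.
    apply/seteqP; split => [n /= [n0 n1]|_ /= [n _ <-] //].
    by exists `|n|.-1%N => //; lia.
  by apply: series_lty => // n m [].
rewrite (_ : _ `&` _ = [set Negz x | x in setT]); last first.
  apply/seteqP; split => [n /= [n0 n1]|_ /= [n _ <-] //].
  by exists `|n|.-1%N => //; lia.
by apply: series_lty => // n m [].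
Qed.

End limits.

Section Hset.
Variables (R : realType) (alpha : R).
Hypotheses (alpha01 : 0 < alpha < 1) (alpha_irr : irrational alpha).
Local Notation q := (cf_den alpha).
Local Notation a := (cf_digit alpha).
Local Notation X n := (dist_int (n%:R * alpha)).

Definition energy_bound (T : R) : R := 27 * 64 * 81 * (T + T ^+ 2 + T ^+ 4).

Definition weight (c : nat -> int) (j : nat) : R := `|(c j)%:~R| ^+ 4 / (a j.+1)%:R.

Definition shift_num (c : nat -> int) (M N : nat) : int := \sum_(M <= j < N) c j * (q j)%:Z.

Lemma weight_ge0 c j : 0 <= weight c j.
Proof. by rewrite divr_ge0 // exprn_ge0. Qed.

Lemma normz_le_pow4 (k : int) : `|k%:~R| <= `|k%:~R| ^+ 4 :> R.
Proof.
have [->|k0] := eqVneq k 0; first by rewrite normr0 expr0n.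
have h : 1 <= `|k%:~R| :> R.
  by rewrite -intr_norm -[1]/(1%:~R) ler_int -gtz0_ge1 normr_gt0.
by rewrite -{1}[`|_|]expr1 ler_weXn2l.
Qed.

Lemma energy_le (c : nat -> int) (M N K : nat) (T : R) :
  \sum_(M <= j < N) weight c j <= T ->
  \sum_(1 <= n < K) dist_int (n%:R * ((shift_num c M N)%:~R * alpha)) ^+ 4 / (n%:R ^+ 2 * X n ^+ 2)
  <= energy_bound T.
Proof.
move=> hT.
(* Truncation to M <= j < N; the number P of indices is then enlarged so as to
   reach all n < K. *)
pose B (j : nat) : R := if (M <= j < N)%N then `|(c j)%:~R| else 0.
have B0 j : 0 <= B j by rewrite /B; case: ifP.
have B4 j : B j <= B j ^+ 4.
  by rewrite /B; case: ifP => _; [exact: normz_le_pow4|rewrite expr0n].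
have sumB (G : nat -> R -> R) P : (forall j, G j 0 = 0) -> (N <= P)%N ->
    \sum_(j < P) G j (B j) = \sum_(M <= j < N) G j `|(c j)%:~R|.
  move=> G0 NP; rewrite -(big_mkord xpredT (fun j => G j (B j))).
  have [MN|NM] := leqP M N; last first.
    rewrite [RHS]big_geq ?(ltnW NM) // big1 // => j _.
    by rewrite /B; case: ifP => // /andP[h1 h2]; lia.
  rewrite (big_cat_nat (n := N)) //= (big_cat_nat (n := M)) //=.
  rewrite big_nat big1 ?add0r; last by move=> j jM; rewrite /B leqNgt; case: ifP => //; lia.
  rewrite [Y in _ + Y]big_nat [Y in _ + Y]big1 ?addr0; last first.
    by move=> j jM; rewrite /B; case: ifP => //; lia.
  by rewrite big_nat [RHS]big_nat; apply: eq_bigr => j h; rewrite /B h.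
set P := maxn N K.
have hb n : dist_int (n%:R * ((shift_num c M N)%:~R * alpha)) <=
    \sum_(j < P) B j * dist_int (n%:R * ((q j)%:R * alpha)).
  rewrite (sumB (fun j x => x * dist_int (n%:R * ((q j)%:R * alpha)))) ?leq_maxl //; last first.
    by move=> j; rewrite mul0r.
  rewrite /shift_num rmorph_sum /= mulr_suml mulr_sumr.
  apply: le_trans (dist_int_sum _ _) _; apply: ler_sum => j _.
  rewrite intrM -mulrA mulrCA; exact: dist_intMz.
have hT' : \sum_(j < P) B j ^+ 4 / (a j.+1)%:R <= T.
  rewrite (sumB (fun j x => x ^+ 4 / (a j.+1)%:R)) ?leq_maxl //.
  by move=> j; rewrite expr0n mul0r.
apply: le_trans (energy_den_le alpha01 alpha_irr B0 B4 hb (leq_maxr N K) hT').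
apply: ler_sum_nat_widen; first exact: cf_den_geS.
move=> n; rewrite divr_ge0 ?mulr_ge0 ?sqr_ge0 ?exprn_ge0 ?dist_int_ge0 //.
Qed.

Lemma H_data (beta : R) : H 4 alpha beta -> exists (c : nat -> int) (T : R),
  [/\ (fun N => dist_int (beta - (shift_num c 0 N)%:~R * alpha)) @ \oo --> (0 : R),
      forall N, \sum_(j < N) weight c j <= T
    & forall eps, 0 < eps -> exists N0, forall N N', (N0 <= N <= N')%N ->
        \sum_(N <= j < N') weight c j <= eps].
Proof.
move=> [_ [b [hb hs]]].
pose c j : int := if j is 0%N then 0 else b j.
have wE j : (0 < j)%N -> (`|(b j)%:~R : R| `^ 4 / (a j.+1)%:R)%:E = (weight c j)%:E.
  by case: j => // j _; rewrite powR_mulrn.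
have [T hT] : exists T, forall N, \sum_(j < N) weight c j <= T.
  move: hs; set L := (X in (X < _)%E) => hs.
  have L0 : (0 <= L)%E.
    by apply: nneseries_ge0 => j j1 _; rewrite wE // lee_fin weight_ge0.
  exists (fine L) => N.
  have -> : \sum_(j < N) weight c j = \sum_(1 <= j < N) weight c j.
    case: N => [|N]; first by rewrite big_ord0 big_geq.
    by rewrite big_ord_recl /= {1}/weight normr0 expr0n mul0r add0r big_add1 /= big_mkord.
  rewrite -lee_fin fineK ?ge0_fin_numE //.
  apply: le_trans (nneseries_lim_ge (P := xpredT) N _); last first.
    by move=> j j1 _; rewrite wE // lee_fin weight_ge0.
  rewrite -sumEFin !big_nat; apply: lee_sum => j /andP[j1 _].
  by rewrite wE.
exists c, T; split => //.
- apply: cvg_trans hb; apply: near_eq_cvg; near=> N; congr (dist_int (_ - _)).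
  rewrite /shift_num rmorph_sum /= mulr_suml.
  have N0 : (0 < N)%N by near: N; exists 1%N.
  rewrite [RHS]big_ltn //= mul0r add0r.
  rewrite !big_nat; apply: eq_bigr => -[//|j] _; by rewrite intrM.
- exact: bounded_sum_tail (weight_ge0 c) hT.
Unshelve. all: by end_near.
Qed.

(** The finite sums of [energy_le] have a uniform bound, and for each n the
distances || n beta_N || converge to || n beta ||. *)
Lemma energy_H (beta : R) : H 4 alpha beta -> exists G, forall K,
  \sum_(1 <= n < K) dist_int (n%:R * beta) ^+ 4 / (n%:R ^+ 2 * X n ^+ 2) <= G.
Proof.
move=> /H_data [c [T [hc hT _]]]; exists (energy_bound T) => K.
apply: (cvg_le_cst (f := fun N => \sum_(1 <= n < K)
   dist_int (n%:R * ((shift_num c 0 N)%:~R * alpha)) ^+ 4 / (n%:R ^+ 2 * X n ^+ 2))); last first.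
  by move=> N; apply: energy_le; rewrite big_mkord.
apply: (cvg_seq_sum (f := fun n N => dist_int (n%:R * ((shift_num c 0 N)%:~R * alpha)) ^+ 4 / (n%:R ^+ 2 * X n ^+ 2))) => n.
apply: cvgM; last exact: cvg_cst.
have h := cvg_dist_int0 (u := fun N => (shift_num c 0 N)%:~R * alpha) (n := n) hc.
exact: (@continuous_cvg _ R R _ _ _ (fun x : R => x ^+ 4) _ (@exprn_continuous R 4 _) h).
Qed.

(** The weight s makes it possible to take the energy of x small while that of y
stays bounded. *)
Lemma pair_energy_le (x y : nat -> R) (s G1 G2 : R) (K : nat) : 0 < s ->
  \sum_(1 <= n < K) x n ^+ 4 / (n%:R ^+ 2 * X n ^+ 2) <= G1 ->
  \sum_(1 <= n < K) y n ^+ 4 / (n%:R ^+ 2 * X n ^+ 2) <= G2 ->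
  \sum_(1 <= n < K) x n ^+ 2 * y n ^+ 2 / (n%:R ^+ 2 * X n ^+ 2) <= s * G1 + G2 / s.
Proof.
move=> s0 h1 h2.
apply: (le_trans (y := \sum_(1 <= n < K) (s * (x n ^+ 4 / (n%:R ^+ 2 * X n ^+ 2))
   + s^-1 * (y n ^+ 4 / (n%:R ^+ 2 * X n ^+ 2))))).
  apply: ler_sum => n _; rewrite [s * (_ / _)]mulrA [s^-1 * (_ / _)]mulrA -mulrDl.
  rewrite ler_wpM2r ?invr_ge0 ?mulr_ge0 ?sqr_ge0 ?dist_int_ge0 //.
  have -> : s * x n ^+ 4 + s^-1 * y n ^+ 4 = s^-1 * ((s * x n ^+ 2) ^+ 2 + (y n ^+ 2) ^+ 2).
    by field; rewrite gt_eqF.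
  rewrite ler_pdivlMl //; have := sqr_ge0 (s * x n ^+ 2 - y n ^+ 2).
  have := mulr_ge0 (ltW s0) (mulr_ge0 (sqr_ge0 (x n)) (sqr_ge0 (y n))).
  nra.
rewrite big_split /= -!mulr_sumr lerD // ?ler_wpM2l // ?(ltW s0) //.
by rewrite [leRHS]mulrC ler_wpM2l // invr_ge0 ltW.
Qed.

End Hset.

(** * The Fourier series of t (1 - t) *)

Section sine.
Variable R : realType.
Implicit Types x y : R.

(** The mean value theorem gives both sin x <= x and x cos x <= sin x. *)
Lemma sin_mvt x : 0 < x -> exists2 c, 0 < c < x & sin x = cos c * x.
Proof.
move=> x0; have [c] := @MVT R sin cos 0 x x0 (fun y _ => is_derive_sin y)
  (continuous_subspaceT (@continuous_sin R)).
by rewrite in_itv /= sin0 !subr0 => cx h; exists c.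
Qed.

Lemma sin_le_id x : 0 <= x -> sin x <= x.
Proof.
rewrite le_eqVlt => /predU1P[<-|x0]; first by rewrite sin0.
by have [c _ ->] := sin_mvt x0; rewrite ler_piMl ?(ltW x0) // cos_le1.
Qed.

Lemma norm_sin_le x : `|sin x| <= `|x|.
Proof.
wlog x0 : x / 0 < x.
  move=> h; have [/h//|] := ltP 0 x; rewrite le_eqVlt => /predU1P[->|x0].
    by rewrite sin0 normr0.
  by have := h (- x); rewrite sinN !normrN; apply; rewrite oppr_gt0.
have [c _ ->] := sin_mvt x0.
by rewrite normrM ler_piMl ?normr_ge0 // cos_max.
Qed.

Lemma mulr_cos_le_sin x : 0 <= x <= pi -> x * cos x <= sin x.
Proof.
move=> /andP[x0 xpi]; move: x0; rewrite le_eqVlt => /predU1P[<-|x0]; first by rewrite sin0 mul0r.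
have [c /andP[c0 cx] ->] := sin_mvt x0; rewrite mulrC ler_wpM2r ?(ltW x0) //.
apply/ltW; rewrite ltr_cos // in_itv /= ?(ltW c0) ?(ltW x0) ?(ltW (lt_le_trans cx xpi)) //.
Qed.

Lemma sin_ge_half x : 0 <= x <= pi / 2 -> x / 2 <= sin x.
Proof.
move=> /andP[x0 x2].
have hpi := pi_ge0 R.
have h1 : (x / 2) * cos (x / 2) <= sin (x / 2) by apply: mulr_cos_le_sin; lra.
have cx : 0 <= cos x by apply: cos_ge0_pihalf; lra.
have c0 : 0 <= cos (x / 2) by apply: cos_ge0_pihalf; lra.
have E : x = (x / 2) *+ 2 by rewrite mulr2n; lra.
rewrite [in sin x]E sin_mulr2n; rewrite E cos_mulr2n in cx.
have a0 : 0 <= x / 2 by lra.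
move: h1 cx c0; move: (sin _) (cos _) => u v h1 cx c0.
have := mulr_ge0 a0 cx; have := ler_wpM2r c0 h1; lra.
Qed.

(** Equivalent to sin x <= x <= tan x. *)
Lemma inv_sin2_itv x : 0 < x -> x < pi / 2 -> x ^- 2 <= sin x ^- 2 <= x ^- 2 + 1.
Proof.
move=> x0 x2; have s0 : 0 < sin x by apply: sin_gt0_pihalf; rewrite x0.
have h1 := sin_le_id (ltW x0).
have h2 : x * cos x <= sin x by apply: mulr_cos_le_sin; have := pi_ge0 R; lra.
have c0 : 0 <= cos x by apply: cos_ge0_pihalf; lra.
rewrite lef_pV2 ?posrE ?exprn_gt0 // lerXn2r ?nnegrE ?(ltW x0) ?(ltW s0) //=.
have h3 : (x * cos x) ^+ 2 <= sin x ^+ 2 by rewrite lerXn2r ?nnegrE ?(ltW s0) // mulr_ge0 // ltW.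
rewrite exprMn cos2sin2 in h3.
rewrite -[leLHS]mul1r ler_pdivrMr ?exprn_gt0 // mulrDl mul1r.
have -> : x ^- 2 * sin x ^+ 2 = sin x ^+ 2 / x ^+ 2 by rewrite mulrC.
rewrite -lerBlDr ler_pdivlMr ?exprn_gt0 //; lra.
Qed.

Lemma sin2_diff x y : `|sin x ^+ 2 - sin y ^+ 2| <= `|x - y|.
Proof.
have -> : sin x ^+ 2 - sin y ^+ 2 = sin (x + y) * sin (x - y).
  rewrite sinB sinD; have := cos2Dsin2 x; have := cos2Dsin2 y.
  move: (sin x) (sin y) (cos x) (cos y) => a b c d h1 h2.
  have -> : (a * d + c * b) * (a * d - c * b) = a ^+ 2 * d ^+ 2 - c ^+ 2 * b ^+ 2 by ring.
  have -> : d ^+ 2 = 1 - b ^+ 2 by lra.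
  have -> : c ^+ 2 = 1 - a ^+ 2 by lra.
  ring.
rewrite normrM; apply: le_trans (norm_sin_le (x - y)).
by rewrite ler_piMl ?normr_ge0 // sin_max.
Qed.

Lemma sin2_piDz x (k : int) : sin (pi * (x + k%:~R)) ^+ 2 = sin (pi * x) ^+ 2.
Proof.
have H (n : nat) y : sin (pi * (y + n%:R)) ^+ 2 = sin (pi * y) ^+ 2.
  by rewrite mulrDr mulr_natr (alternatingn (@sinDpi R)) exprMn sqrr_sign mul1r.
case: k => n; first exact: H.
by rewrite NegzE intrN -(H n.+1) -addrA addNr addr0.
Qed.

Lemma sin2_pi_dist x : sin (pi * x) ^+ 2 = sin (pi * dist_int x) ^+ 2.
Proof.
have [m [-> _]] := dist_int_round x.
rewrite -[in LHS](sin2_piDz x (- m)) intrN.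
have [h|h] := leP 0 (x - m%:~R); first by rewrite ger0_norm.
by rewrite ltr0_norm // mulrN sinN sqrrN.
Qed.

Lemma sin2_pi_le x : sin (pi * x) ^+ 2 <= pi ^+ 2 * dist_int x ^+ 2.
Proof.
have d0 := dist_int_ge0 x; have p0 := pi_ge0 R; have d2 := dist_int_le_half x.
rewrite sin2_pi_dist -exprMn lerXn2r ?nnegrE ?mulr_ge0 //.
  by apply: sin_ge0_pi; nra.
by apply: sin_le_id; rewrite mulr_ge0.
Qed.

Lemma sin2_pi_ge x : pi ^+ 2 * dist_int x ^+ 2 <= 4 * sin (pi * x) ^+ 2.
Proof.
have d0 := dist_int_ge0 x; have p0 := pi_ge0 R; have d2 := dist_int_le_half x.
have h : pi * dist_int x / 2 <= sin (pi * dist_int x) by apply: sin_ge_half; nra.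
rewrite sin2_pi_dist.
have h0 : 0 <= pi * dist_int x by rewrite mulr_ge0.
nra.
Qed.

Lemma sum_cos_dirichlet (L : nat) x : sin x != 0 ->
  \sum_(k < L) cos (k.+1%:R * x *+ 2) = (sin (L.*2.+1%:R * x) / sin x - 1) / 2.
Proof.
move=> s0; elim: L => [|L IH]; first by rewrite big_ord0 mul1r divff // subrr mul0r.
rewrite big_ord_recr /= IH.
have E1 : L.+1.*2.+1%:R * x = L.+1%:R * x *+ 2 + x.
  by rewrite doubleS -!muln2 -!natr1 natrM -natr1 mulr2n; ring.
have E2 : L.*2.+1%:R * x = L.+1%:R * x *+ 2 - x.
  by rewrite -!muln2 -!natr1 natrM mulr2n; ring.
rewrite E1 E2 (sinB (L.+1%:R * x *+ 2) x) (sinD (L.+1%:R * x *+ 2) x); by field.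
Qed.

Lemma sin2_second_diff x y :
  sin (x + y) ^+ 2 + sin (x - y) ^+ 2 - 2 * sin x ^+ 2 = 2 * sin y ^+ 2 * cos (x *+ 2).
Proof.
rewrite sinB sinD cos_mulr2n.
have := cos2Dsin2 x; have := cos2Dsin2 y.
move: (sin x) (sin y) (cos x) (cos y) => a b c d h1 h2.
have -> : (a * d + c * b) ^+ 2 + (a * d - c * b) ^+ 2 = 2 * (a ^+ 2 * d ^+ 2 + c ^+ 2 * b ^+ 2) by ring.
have -> : d ^+ 2 = 1 - b ^+ 2 by lra.
rewrite mulr2n.
have -> : c ^+ 2 = 1 - a ^+ 2 by lra.
ring.
Qed.

(** As a function of m, the left-hand side has second difference
2 \sum_k cos (2 pi k (m + 1) / Q) = -1, where Q = 2 L + 1, and it takes the values 0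
and L at m = 0 and m = 1. *)
Lemma sum_sin2_ratio (L m : nat) : (m <= L.*2.+1)%N ->
  \sum_(k < L) sin (m%:R * (pi * k.+1%:R / L.*2.+1%:R)) ^+ 2 / sin (pi * k.+1%:R / L.*2.+1%:R) ^+ 2
  = m%:R * (L.*2.+1%:R - m%:R) / 2 :> R.
Proof.
set Q := L.*2.+1.
have Q0 : 0 < Q%:R :> R by rewrite ltr0n.
have pi0 := pi_gt0 R.
pose y (k : 'I_L) : R := pi * k.+1%:R / Q%:R.
have sy k : 0 < sin (y k).
  apply: sin_gt0_pi; rewrite /y divr_gt0 ?mulr_gt0 //= ltr_pdivrMr // ltr_pM2l // ltr_nat.
  by rewrite /Q; have := ltn_ord k; lia.
pose F (m : nat) := \sum_(k < L) sin (m%:R * y k) ^+ 2 / sin (y k) ^+ 2.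
have F0 : F 0%N = 0.
  by rewrite /F big1 // => k _; rewrite mul0r sin0 expr0n mul0r.
have F1 : F 1%N = L%:R.
  rewrite /F (eq_bigr (fun=> 1)); first by rewrite sumr_const card_ord.
  by move=> k _; rewrite mul1r divff // expf_neq0 // gt_eqF.
have FS n : (n.+1 < Q)%N -> F n.+2 = 2 * F n.+1 - F n - 1.
  move=> nQ.
  suff : F n.+2 + F n - 2 * F n.+1 = - 1 by lra.
  rewrite /F mulr_sumr -big_split -sumrB /=.
  pose x : R := pi * n.+1%:R / Q%:R.
  have sx : 0 < sin x.
    by apply: sin_gt0_pi; rewrite /x divr_gt0 ?mulr_gt0 //= ltr_pdivrMr // ltr_pM2l // ltr_nat.
  transitivity (2 * \sum_(k < L) cos (k.+1%:R * x *+ 2)).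
    rewrite mulr_sumr; apply: eq_bigr => k _.
    have -> : k.+1%:R * x = n.+1%:R * y k by rewrite /x /y; ring.
    have h := sin2_second_diff (n.+1%:R * y k) (y k).
    have E1 : n.+1%:R * y k + y k = n.+2%:R * y k by rewrite -[n.+2%:R]natr1; ring.
    have E2 : n.+1%:R * y k - y k = n%:R * y k by rewrite -[n.+1%:R]natr1; ring.
    rewrite E1 E2 in h.
    have s0 : sin (y k) != 0 by rewrite gt_eqF.
    rewrite mulrA -mulrDl -mulrBl h; by field.
  rewrite sum_cos_dirichlet ?gt_eqF // -/Q.
  have -> : Q%:R * x = 0 + pi *+ n.+1 by rewrite /x -mulr_natr; field; rewrite gt_eqF.
  rewrite (alternatingn (@sinDpi R)) sin0 mulr0 mul0r; lra.
suff H n : (n < Q)%N -> F n = n%:R * (Q%:R - n%:R) / 2 /\ F n.+1 = n.+1%:R * (Q%:R - n.+1%:R) / 2.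
  case: m => [|m] mQ; first by have := F0; rewrite /F /y => ->; rewrite !mul0r.
  by have [_] := H m mQ.
have QE : Q%:R = 2 * L%:R + 1 :> R by rewrite /Q -muln2 -natr1 natrM; ring.
elim: n => [|n IH] nQ; first by rewrite F0 F1 QE; split; lra.
have [h1 h2] := IH (ltnW nQ).
split => //; rewrite FS // h1 h2 -!natr1; by field.
Qed.

Definition sin2_sum (K : nat) x : R := \sum_(k < K) sin (pi * (k.+1%:R * x)) ^+ 2 / k.+1%:R ^+ 2.

(** With y = pi k / Q, replacing 1 / sin^2 y by 1 / y^2 in [sum_sin2_ratio] costs at
most 1 per term, which is then divided by Q^2. *)
Lemma parabola_grid (L m : nat) (t : R) : (m <= L.*2.+1)%N -> t = m%:R / L.*2.+1%:R ->
  `|t * (1 - t) - 2 / pi ^+ 2 * sin2_sum L t| <= (L.*2.+1%:R)^-1.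
Proof.
move=> mQ; set Q := L.*2.+1 => tE.
have Q0 : 0 < Q%:R :> R by rewrite ltr0n.
have pi0 := pi_gt0 R.
have hs := sum_sin2_ratio mQ; rewrite -/Q in hs.
have -> : t * (1 - t) = 2 / Q%:R ^+ 2 * (m%:R * (Q%:R - m%:R) / 2).
  by rewrite tE; field; rewrite gt_eqF.
rewrite -hs /sin2_sum !mulr_sumr -sumrB.
apply: le_trans (ler_norm_sum _ _ _) _.
apply: (le_trans (y := \sum_(k < L) 2 / Q%:R ^+ 2)); last first.
  rewrite sumr_const card_ord -[_ *+ L]mulr_natl.
  have -> : L%:R * (2 / Q%:R ^+ 2) = (2 * L%:R) / Q%:R / Q%:R :> R by field; rewrite gt_eqF.
  rewrite -[leRHS]mul1r ler_wpM2r ?invr_ge0 // ler_pdivrMr // mul1r -natrM ler_nat /Q; lia.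
apply: ler_sum => k _.
set y : R := pi * k.+1%:R / Q%:R.
have y0 : 0 < y by rewrite divr_gt0 ?mulr_gt0.
have y2 : y < pi / 2.
  rewrite /y ltr_pdivrMr // mulrAC -mulrA ltr_pM2l // ltr_pdivlMr // -natrM ltr_nat /Q.
  by have := ltn_ord k; lia.
have /andP[h1 h2] := inv_sin2_itv y0 y2.
have -> : pi * (k.+1%:R * t) = m%:R * y by rewrite tE /y; ring.
set u := sin (m%:R * y).
have k0 : 0 < k.+1%:R :> R by [].
have -> : 2 / pi ^+ 2 * (u ^+ 2 / k.+1%:R ^+ 2) = 2 / Q%:R ^+ 2 * (u ^+ 2 * y ^- 2).
  have E (p r k' v : R) : p != 0 -> r != 0 -> k' != 0 ->
      2 / p ^+ 2 * (v ^+ 2 / k' ^+ 2) = 2 / r ^+ 2 * (v ^+ 2 * (p * k' / r) ^- 2).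
    by move=> *; field; apply/and3P.
  by apply: E; rewrite gt_eqF.
rewrite -mulrBr -mulrBr normrM ger0_norm ?divr_ge0 ?sqr_ge0 //.
rewrite ler_piMr ?divr_ge0 ?sqr_ge0 // normrM ger0_norm ?sqr_ge0 //.
rewrite ger0_norm ?subr_ge0 //.
have : u ^+ 2 <= 1 by have := cos2Dsin2 (m%:R * y); have := sqr_ge0 (cos (m%:R * y)); rewrite /u; lra.
have := sqr_ge0 u; nra.
Qed.


Lemma sum_inv_sq_tail (K M : nat) : (0 < K)%N ->
  \sum_(k < M) ((K + k).+1%:R ^- 2 : R) <= K%:R^-1.
Proof.
move=> K0; have K0' : 0 < K%:R :> R by rewrite ltr0n.
suff : \sum_(k < M) ((K + k).+1%:R ^- 2 : R) + (K + M)%:R^-1 <= K%:R^-1.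
  have : 0 <= (K + M)%:R^-1 :> R by [].
  lra.
elim: M => [|M IH]; first by rewrite big_ord0 add0r addn0.
rewrite big_ord_recr /= addnS -addrA; apply: le_trans IH; rewrite lerD2l.
have x0 : 0 < (K + M)%:R :> R by rewrite ltr0n addn_gt0 K0.
rewrite -natr1; move: x0; move: (K + M)%:R => x x0.
have -> : (x + 1) ^- 2 + (x + 1)^-1 = (x + 2) / (x + 1) ^+ 2.
  by field; rewrite gt_eqF //; lra.
rewrite ler_pdivrMr ?exprn_gt0 //; last by lra.
rewrite ler_pdivlMl //; nra.
Qed.

(** Approximation of t by the grid point u = m / Q, where Q = 2 K^2 + 1: the first
K terms of the series are moved by O (1 / Q) each, and the terms from K + 1 to K^2
are bounded by the tail of \sum 1 / k^2. *)
Lemma parabola_series (t : R) (K : nat) : 0 <= t < 1 -> (0 < K)%N ->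
  `|t * (1 - t) - 2 / pi ^+ 2 * sin2_sum K t| <= 3 / K%:R.
Proof.
move=> /andP[t0 t1] K0.
have K0' : 0 < K%:R :> R by rewrite ltr0n.
have [L LE] : exists L, L = (K * K)%N by exists (K * K)%N.
pose Q := L.*2.+1.
have Q0 : 0 < Q%:R :> R by rewrite ltr0n.
have KL : (K <= L)%N by rewrite LE leq_pmulr.
pose m := Num.truncn (t * Q%:R).
have /andP[m1 m2] : m%:R <= t * Q%:R < m.+1%:R by apply: truncn_itv; rewrite mulr_ge0.
have mQ : (m <= L.*2.+1)%N.
  rewrite -(ler_nat R); apply: le_trans m1 _; rewrite ler_piMl ?(ltW t1) //.
pose u : R := m%:R / Q%:R.
have hu := parabola_grid mQ (erefl u); rewrite -/Q in hu.
have u0 : 0 <= u by rewrite divr_ge0.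
have ut : u <= t by rewrite ler_pdivrMr.
have tu : t - u <= Q%:R^-1.
  by rewrite -[leRHS]mul1r ler_pdivlMr // mulrBl /u divfK ?gt_eqF // lerBlDl natr1 ltW.
have QK : Q%:R^-1 <= (2 * K%:R)^-1 :> R.
  by rewrite lef_pV2 ?posrE ?mulr_gt0 // -natrM ler_nat mul2n leqW // leq_double.
have h2 : `|u * (1 - u) - t * (1 - t)| <= (2 * K%:R)^-1.
  have -> : u * (1 - u) - t * (1 - t) = (t - u) * (t + u - 1) by ring.
  rewrite normrM ger0_norm ?subr_ge0 //; apply: (le_trans (y := (t - u) * 1)); last by lra.
  rewrite ler_wpM2l ?subr_ge0 // ler_norml; lra.
have pi0 := pi_gt0 R; have pi2 := pi_ge2 R; have pi4 := pihalf_lt2 R.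
have h3 : `|sin2_sum L u - sin2_sum K t| <= pi / (2 * K%:R) + K%:R^-1.
  have -> : sin2_sum L u = sin2_sum K u +
      \sum_(k < L - K) sin (pi * ((K + k).+1%:R * u)) ^+ 2 / (K + k).+1%:R ^+ 2.
    pose F k := sin (pi * (k.+1%:R * u)) ^+ 2 / k.+1%:R ^+ 2.
    rewrite /sin2_sum -!(big_mkord xpredT F) (big_cat_nat (n := K)) //=; congr (_ + _).
    by rewrite -{1}[K]add0n big_addn big_mkord; apply: eq_bigr => i _; rewrite addnC.
  rewrite addrAC; apply: le_trans (ler_normD _ _) _; apply: lerD; last first.
    rewrite ger0_norm; last by apply: sumr_ge0 => k _; rewrite divr_ge0 ?sqr_ge0.
    apply: le_trans (sum_inv_sq_tail (L - K) K0); apply: ler_sum => k _.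
    by rewrite -[leRHS]mul1r ler_wpM2r ?invr_ge0 ?sqr_ge0 //.
  rewrite /sin2_sum -sumrB; apply: le_trans (ler_norm_sum _ _ _) _.
  apply: (le_trans (y := \sum_(k < K) pi / Q%:R)).
    apply: ler_sum => k _; rewrite -mulrBl normrM.
    have k0 : 0 < k.+1%:R :> R by [].
    rewrite [`|_^-1|]ger0_norm ?invr_ge0 ?sqr_ge0 // ler_pdivrMr ?exprn_gt0 //.
    apply: le_trans (sin2_diff _ _) _; rewrite -!mulrBr normrM (ger0_norm (ltW pi0)).
    rewrite -[leRHS]mulrA ler_wpM2l ?(ltW pi0) // normrM ger0_norm // distrC ger0_norm ?subr_ge0 //.
    apply: (le_trans (y := k.+1%:R * Q%:R^-1)); first by rewrite ler_wpM2l.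
    rewrite mulrC ler_wpM2l ?invr_ge0 // expr2 ler_peMr // ler1n //.
  rewrite sumr_const card_ord -[_ *+ K]mulr_natl.
  have -> : K%:R * (pi / Q%:R) = pi * (K%:R / Q%:R) :> R by rewrite mulrCA.
  rewrite ler_wpM2l ?(ltW pi0) // ler_pdivrMr // ler_pdivlMl ?mulr_gt0 //.
  have h : (2 * K * K = L.*2)%N by rewrite LE -mulnA mul2n.
  by rewrite -!natrM ler_nat h.
have p2 : 0 < pi ^+ 2 :> R by rewrite exprn_gt0.
have -> : t * (1 - t) - 2 / pi ^+ 2 * sin2_sum K t =
  - (u * (1 - u) - t * (1 - t)) + (u * (1 - u) - 2 / pi ^+ 2 * sin2_sum L u)
  + 2 / pi ^+ 2 * (sin2_sum L u - sin2_sum K t) by ring.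
apply: le_trans (ler_normD _ _) _.
apply: le_trans (lerD (ler_normD _ _) (lexx _)) _; rewrite normrN normrM.
rewrite (ger0_norm (x := 2 / _)) ?divr_ge0 ?(ltW p2) //.
have c2 : 2 / pi ^+ 2 <= 1 / 2 :> R.
  rewrite ler_pdivrMr // expr2; have : 2 * 2 <= (pi : R) * pi by apply: ler_pM.
  lra.
have h4 : 2 / pi ^+ 2 * `|sin2_sum L u - sin2_sum K t| <= 1 / 2 * (pi / (2 * K%:R) + K%:R^-1).
  by apply: ler_pM; rewrite ?divr_ge0 ?(ltW p2) ?normr_ge0.
have Ki : 0 < K%:R^-1 :> R by rewrite invr_gt0.
have piK : pi / (2 * K%:R) <= 2 * K%:R^-1 :> R by rewrite invfM mulrA ler_wpM2r ?(ltW Ki) //; lra.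
rewrite invfM in QK h2; lra.
Qed.

Lemma parabola_frac_cvg x :
  (fun K => 2 / pi ^+ 2 * sin2_sum K x) @ \oo --> frac_part x * (1 - frac_part x).
Proof.
have E K : sin2_sum K x = sin2_sum K (frac_part x).
  rewrite /sin2_sum; apply: eq_bigr => k _; congr (_ / _).
  rewrite -(sin2_piDz (k.+1%:R * frac_part x) (k.+1%:Z * Num.floor x)) intrM -mulrDr.
  by rewrite /frac_part subrK.
apply/cvgrPdist_le => eps eps0.
near=> K; rewrite E.
have K0 : (0 < K)%N by near: K; exists 1%N.
have K0' : 0 < K%:R :> R by rewrite ltr0n.
apply: le_trans (parabola_series (frac_part_itv x) K0) _.
rewrite ler_pdivrMr // -ler_pdivrMl //.
near: K; exists (Num.truncn (eps^-1 * 3)).+1 => // n /= h.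
apply: ltW; apply: lt_le_trans (truncnS_gt _) _; by rewrite ler_nat.
Unshelve. all: by end_near.
Qed.

End sine.

(** * Trigonometric identities *)

Section exponential_sums.
Variable R : realType.
Implicit Types x z : R.

(** The squared modulus of the sum of the geometric progression exp (2 i x)^k. *)
Lemma dirichlet_square (K : nat) x :
  ((\sum_(i < K) cos (i%:R * x *+ 2)) ^+ 2 + (\sum_(i < K) sin (i%:R * x *+ 2)) ^+ 2) * sin x ^+ 2
  = sin (K%:R * x) ^+ 2.
Proof.
set w := K%:R * x *+ 2 - x.
have hC : 2 * sin x * \sum_(i < K) cos (i%:R * x *+ 2) = sin w + sin x.
  rewrite /w; elim: K {w} => [|K IH].
    by rewrite big_ord0 mul0r mul0rn sub0r sinN addNr mulr0.
  rewrite big_ord_recr /= mulrDr IH.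
  have -> : K.+1%:R * x *+ 2 - x = K%:R * x *+ 2 + x by rewrite -natr1; ring.
  rewrite (sinB (K%:R * x *+ 2) x) (sinD (K%:R * x *+ 2) x); ring.
have hS : 2 * sin x * \sum_(i < K) sin (i%:R * x *+ 2) = cos x - cos w.
  rewrite /w; elim: K {w hC} => [|K IH].
    by rewrite big_ord0 mul0r mul0rn sub0r cosN subrr mulr0.
  rewrite big_ord_recr /= mulrDr IH.
  have -> : K.+1%:R * x *+ 2 - x = K%:R * x *+ 2 + x by rewrite -natr1; ring.
  rewrite (cosB (K%:R * x *+ 2) x) (cosD (K%:R * x *+ 2) x); ring.
move: hC hS; set C := \sum_(_ < _) _; set S := \sum_(_ < _) _ => hC hS.
have h4 : 4 * ((C ^+ 2 + S ^+ 2) * sin x ^+ 2) = 4 * sin (K%:R * x) ^+ 2.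
  have -> : 4 * ((C ^+ 2 + S ^+ 2) * sin x ^+ 2) = (2 * sin x * C) ^+ 2 + (2 * sin x * S) ^+ 2 by ring.
  rewrite hC hS.
  have E : cos (w + x) = 1 - 2 * sin (K%:R * x) ^+ 2.
    by rewrite /w subrK cos_mulr2n cos2sin2; ring.
  rewrite cosD in E.
  have h1 := cos2Dsin2 w; have h2 := cos2Dsin2 x; nra.
by apply: (mulfI _ h4); rewrite pnatr_eq0.
Qed.

(** By 2 sin^2 = 1 - cos, and since the c_i sum to 0, this is the squared modulus of
\sum_k c_k exp (2 i y_k) up to the factor -1/2. *)
Lemma sin2_quadratic_form (I : finType) (c y : I -> R) : \sum_i c i = 0 ->
  \sum_i \sum_j c i * c j * sin (y i - y j) ^+ 2 =
  - ((\sum_i c i * cos (y i *+ 2)) ^+ 2 + (\sum_i c i * sin (y i *+ 2)) ^+ 2) / 2.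
Proof.
move=> c0.
have E i j : c i * c j * sin (y i - y j) ^+ 2 = c i / 2 * c j
   - (c i * cos (y i *+ 2) / 2 * (c j * cos (y j *+ 2)) + c i * sin (y i *+ 2) / 2 * (c j * sin (y j *+ 2))).
  have h : 2 * sin (y i - y j) ^+ 2 = 1 - cos ((y i - y j) *+ 2) by rewrite cos_mulr2n cos2sin2; ring.
  have h2 : cos ((y i - y j) *+ 2) = cos (y i *+ 2) * cos (y j *+ 2) + sin (y i *+ 2) * sin (y j *+ 2).
    by rewrite mulrnBl cosB.
  rewrite h2 in h; have -> : sin (y i - y j) ^+ 2 = (2 * sin (y i - y j) ^+ 2) / 2 by field.
  rewrite h; by field.
under eq_bigr => i _ do under eq_bigr => j _ do rewrite E.
under eq_bigr => i _ do rewrite sumrB big_split /= -!mulr_sumr c0 mulr0 sub0r.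
rewrite sumrN big_split /= -!mulr_suml; ring.
Qed.

End exponential_sums.

(** * Integrals of finite sums of translated sawtooth functions *)

Section circle_integral.
Variable R : realType.
Local Notation mu := (circle_measure R).
Local Notation mR := (measurableTypeR R).

Lemma measurable_frac_shift (a : R) :
  measurable_fun setT (fun x : mR => frac_part (x + a) : mR).
Proof.
have h : measurable_fun setT (fun x : mR => x + a : mR) by exact: measurable_funD.
rewrite /frac_part; apply: measurable_funB => //.
apply: (nondecreasing_measurable (f := fun x : R => (Num.floor (x + a))%:~R)) => // x y xy.
by rewrite ler_int le_floor // lerD2r.
Qed.

Lemma circle_measureE (A : set R) :
  mu A = lebesgue_measure (A `&` `[0, 1[%classic).
Proof. by []. Qed.

Lemma circle_measureT : mu setT = 1%E.
Proof.
rewrite circle_measureE setTI lebesgue_measure_itv /= lte01.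
by rewrite oppr0 adde0.
Qed.

Lemma circle_measure_le1 (A : set mR) : measurable A -> (mu A <= 1)%E.
Proof. by move=> mA; rewrite -circle_measureT le_measure ?inE. Qed.

Lemma circle_integrable_indic (A : set mR) : measurable A ->
  mu.-integrable setT (fun x => (\1_A x)%:E).
Proof.
move=> mA; apply/integrableP; split.
  by apply/measurable_EFinP; exact: measurable_indic.
under eq_integral => x _ do rewrite gee0_abs ?lee_fin //.
rewrite integral_indic // setIT.
by apply: le_lt_trans (circle_measure_le1 mA) _; rewrite ltry.
Qed.

(** The points of the circle at which adding t to x + b passes an integer. *)
Definition late_arc (b t : R) : set mR := [set x | 1 - t <= frac_part (x + b)].

Lemma measurable_late_arc b t : measurable (late_arc b t).
Proof.
have -> : late_arc b t = setT `&` (fun x : mR => frac_part (x + b)) @^-1` `[1 - t, +oo[%classic.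
  by rewrite setTI; apply/seteqP; split => x /=; rewrite in_itv /= andbT.
exact: measurable_frac_shift.
Qed.

Lemma frac_partE (x y : R) (k : int) : 0 <= y < 1 -> x = y + k%:~R -> frac_part x = y.
Proof.
move=> y01 ->; rewrite /frac_part.
have -> : Num.floor (y + k%:~R) = k; last by rewrite addrK.
by apply: floor_def; rewrite intrD; lra.
Qed.

Lemma circle_measure_late_arc b t : 0 <= t < 1 -> mu (late_arc b t) = t%:E.
Proof.
move=> /andP[t0 t1]; rewrite circle_measureE.
have /andP[d0 d1] := frac_part_itv b; set d := frac_part b in d0 d1.
have bE : b = d + (Num.floor b)%:~R by rewrite /d /frac_part subrK.
have F1 x : 0 <= x < 1 - d -> frac_part (x + b) = x + d.
  by move=> h; apply: (frac_partE (k := Num.floor b)); [lra|rewrite {1}bE addrA].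
have F2 x : 1 - d <= x < 1 -> frac_part (x + b) = x + d - 1.
  move=> h; apply: (frac_partE (k := Num.floor b + 1)); first by lra.
  by rewrite {1}bE intrD; ring.
have [dt|td] := leP d (1 - t).
  have -> : late_arc b t `&` `[0, 1[%classic = `[1 - t - d, 1 - d[%classic.
    apply/seteqP; split => x /=; rewrite /late_arc /= !in_itv /=.
      move=> [h /andP[x0 x1]]; have [xd|dx] := ltP x (1 - d).
        by rewrite F1 in h; lra.
      by rewrite F2 in h; lra.
    move=> /andP[h1 h2]; split; last by lra.
    by rewrite F1; lra.
  rewrite lebesgue_measure_itv /= lte_fin.
  case: ltP => h; rewrite -?EFinB; congr (_%:E); lra.
have -> : late_arc b t `&` `[0, 1[%classic = `[0, 1 - d[%classic `|` `[2 - t - d, 1[%classic.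
  apply/seteqP; split => x /=; rewrite /late_arc /= !in_itv /=.
    move=> [h /andP[x0 x1]]; have [xd|dx] := ltP x (1 - d).
      by left; lra.
    by rewrite F2 in h; [right|]; lra.
  move=> [|] /andP[h1 h2]; (split; last by lra).
    by rewrite F1; lra.
  by rewrite F2; lra.
pose A1 : set R := `[0, 1 - d[%classic; pose A2 : set R := `[2 - t - d, 1[%classic.
have -> : lebesgue_measure (A1 `|` A2) = (lebesgue_measure A1 + lebesgue_measure A2)%E.
  apply: measureU; [exact: measurable_itv|exact: measurable_itv|].
  by apply/seteqP; split => x //=; rewrite /A1 /A2 /= !in_itv /=; lra.
rewrite /A1 /A2.
rewrite !lebesgue_measure_itv /= !lte_fin.
have -> : 0 < 1 - d by lra.
have -> : 2 - t - d < 1 by lra.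
rewrite -!EFinB -EFinD; congr (_%:E); lra.
Qed.

(** The difference is t outside [late_arc b t], and t - 1 on it. *)
Lemma frac_diff_sqr (x a b : R) : let t := frac_part (a - b) in
  (frac_part (x + a) - frac_part (x + b)) ^+ 2 = t ^+ 2 + (1 - 2 * t) * \1_(late_arc b t) x.
Proof.
move=> t; have /andP[t0 t1] := frac_part_itv (a - b); rewrite -/t in t0 t1.
have /andP[y0 y1] := frac_part_itv (x + b); set y := frac_part (x + b) in y0 y1 *.
have E : x + a = y + t + (Num.floor (x + b) + Num.floor (a - b))%:~R.
  by rewrite intrD /y /t /frac_part; ring.
have [h|h] := leP (1 - t) y.
  rewrite indicE mem_set //.
  have -> : frac_part (x + a) = y + t - 1.
    apply: (frac_partE (k := Num.floor (x + b) + Num.floor (a - b) + 1)); first by lra.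
    by rewrite E [in RHS]intrD; ring.
  rewrite mulr1; ring.
rewrite indicE memNset; last by rewrite /late_arc /= -/y; apply/negP; rewrite -ltNge.
have -> : frac_part (x + a) = y + t by apply: (frac_partE _ E); lra.
rewrite mulr0; ring.
Qed.

(** Since the c_i sum to 0, the square of the sum is
-1/2 \sum c_i c_j (sigma_i - sigma_j)^2, and each squared difference has integral
t (1 - t)^2 + (1 - t) t^2 = t (1 - t). *)
Lemma integral_sawtooth_sqr (I : finType) (c a : I -> R) : \sum_i c i = 0 ->
  (\int[mu]_x ((\sum_i c i * frac_part (x + a i)) ^+ 2)%:E)%E =
  (- (\sum_i \sum_j c i * c j * (frac_part (a i - a j) * (1 - frac_part (a i - a j)))) / 2)%:E.
Proof.
move=> c0.
pose t (p : I * I) := frac_part (a p.1 - a p.2).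
pose w (p : I * I) := - (c p.1 * c p.2) / 2.
have E x : (\sum_i c i * frac_part (x + a i)) ^+ 2 =
    \sum_p (w p * t p ^+ 2 * \1_[set: mR] x + w p * (1 - 2 * t p) * \1_(late_arc (a p.2) (t p)) x).
  transitivity (\sum_i \sum_j - (c i * c j) / 2 * (frac_part (x + a i) - frac_part (x + a j)) ^+ 2).
    pose s i := frac_part (x + a i); rewrite -/(s _).
    have E1 i j : - (c i * c j) / 2 * (s i - s j) ^+ 2 =
        c i * s i * (c j * s j) - (c i * s i ^+ 2 / 2 * c j + c i / 2 * (c j * s j ^+ 2)) by field.
    under [RHS]eq_bigr => i _ do under eq_bigr => j _ do rewrite -/(s i) -/(s j) E1.
    under [RHS]eq_bigr => i _ do rewrite sumrB big_split /= -!mulr_sumr c0 mulr0 add0r.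
    by rewrite sumrB -!mulr_suml c0 mul0r mul0r subr0 expr2.
  rewrite pair_bigA /=; apply: eq_bigr => p _.
  rewrite (frac_diff_sqr x) -/(t p) indicT /= /w; ring.
pose f (A : set mR) (r : R) (x : mR) := (r%:E * (\1_A x)%:E)%E.
have fint A r : measurable A -> mu.-integrable setT (f A r).
  by move=> mA; apply: integrableZl => //; exact: circle_integrable_indic.
have fE A r : measurable A -> (\int[mu]_x f A r x = r%:E * mu A)%E.
  move=> mA; rewrite integralZl //; last exact: circle_integrable_indic.
  by rewrite integral_indic // setIT.
rewrite (eq_integral (fun x => \sum_p (f setT (w p * t p ^+ 2)%R \+
    f (late_arc (a p.2) (t p)) (w p * (1 - 2 * t p))%R) x)%E); last first.
  move=> x _; rewrite E -sumEFin; apply: eq_bigr => p _.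
  by rewrite /f /= -!EFinM -EFinD.
have mA p := measurable_late_arc (a p.2) (t p).
rewrite integral_sum //; last by move=> p; apply: integrableD => //; apply: fint.
rewrite pair_bigA /= -sumrN mulr_suml -sumEFin; apply: eq_bigr => p _.
rewrite integralD //; [|exact: fint|exact: fint].
rewrite !fE // circle_measureT circle_measure_late_arc ?frac_part_itv // mule1 -EFinM -EFinD.
congr (_%:E); rewrite /w -/(t p); by field.
Qed.

End circle_integral.

(** * Norms of sums along the orbit *)

Section orbit_sums.
Variables (R : realType) (alpha : R).
Hypotheses (alpha01 : 0 < alpha < 1) (alpha_irr : irrational alpha).
Local Notation mu := (circle_measure R).
Local Notation X n := (dist_int (n%:R * alpha)).

Definition orbit_sum (gamma : R) (K : nat) (u x : R) : R :=
  \sum_(i < K) (frac_part (x + (u + i%:R * alpha)) - frac_part (x + (u + i%:R * alpha + gamma))).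

Lemma rotate_sum_sqr (I : finType) (y : I -> R) (w : R) :
  (\sum_i cos (y i + w)) ^+ 2 + (\sum_i sin (y i + w)) ^+ 2 =
  (\sum_i cos (y i)) ^+ 2 + (\sum_i sin (y i)) ^+ 2.
Proof.
under eq_bigr => i _ do rewrite cosD.
under [Y in _ + Y ^+ 2 = _]eq_bigr => i _ do rewrite sinD.
rewrite sumrB big_split /= -!mulr_suml.
set C := \sum_i cos _; set S := \sum_i sin _.
have := cos2Dsin2 w; move: (cos w) (sin w) => c s h.
transitivity ((C ^+ 2 + S ^+ 2) * (c ^+ 2 + s ^+ 2)); first by ring.
by rewrite h mulr1.
Qed.

(** Real form of |1 - exp (2 i z)|^2 = 4 sin^2 z. *)
Lemma chord_sum_sqr (I : finType) (y : I -> R) (z : R) :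
  (\sum_i (cos (y i) - cos (y i + z *+ 2))) ^+ 2 + (\sum_i (sin (y i) - sin (y i + z *+ 2))) ^+ 2 =
  4 * sin z ^+ 2 * ((\sum_i cos (y i)) ^+ 2 + (\sum_i sin (y i)) ^+ 2).
Proof.
rewrite -(rotate_sum_sqr y z).
have E1 i : cos (y i) - cos (y i + z *+ 2) = 2 * sin z * sin (y i + z).
  have -> : y i + z *+ 2 = (y i + z) + z by rewrite mulr2n addrA.
  rewrite -{1}(addrK z (y i)) (cosB (y i + z) z) (cosD (y i + z) z); ring.
have E2 i : sin (y i) - sin (y i + z *+ 2) = - 2 * sin z * cos (y i + z).
  have -> : y i + z *+ 2 = (y i + z) + z by rewrite mulr2n addrA.
  rewrite -{1}(addrK z (y i)) (sinB (y i + z) z) (sinD (y i + z) z); ring.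
under eq_bigr => i _ do rewrite E1.
under [Y in _ + Y ^+ 2 = _]eq_bigr => i _ do rewrite E2.
rewrite -!mulr_sumr; ring.
Qed.

Lemma fourier_coef_le (gamma u : R) (K n : nat) : (0 < n)%N ->
  (\sum_(i < K) (cos (pi * (n%:R * (u + i%:R * alpha)) *+ 2)
     - cos (pi * (n%:R * (u + i%:R * alpha + gamma)) *+ 2))) ^+ 2 +
  (\sum_(i < K) (sin (pi * (n%:R * (u + i%:R * alpha)) *+ 2)
     - sin (pi * (n%:R * (u + i%:R * alpha + gamma)) *+ 2))) ^+ 2 <=
  16 * pi ^+ 2 * (dist_int (n%:R * (K%:R * alpha)) ^+ 2 * dist_int (n%:R * gamma) ^+ 2 / X n ^+ 2).
Proof.
move=> n0.
pose x := pi * (n%:R * alpha); pose z := pi * (n%:R * gamma).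
pose w := pi * (n%:R * u) *+ 2.
pose y (i : 'I_K) := i%:R * x *+ 2 + w.
have Ey (i : 'I_K) : pi * (n%:R * (u + i%:R * alpha)) *+ 2 = y i.
  by rewrite /y /w /x -mulrnDl; congr (_ *+ 2); ring.
have Ez (i : 'I_K) : pi * (n%:R * (u + i%:R * alpha + gamma)) *+ 2 = y i + z *+ 2.
  by rewrite -Ey /z -mulrnDl; congr (_ *+ 2); ring.
under eq_bigr => i _ do rewrite Ey Ez.
under [Y in _ + Y ^+ 2]eq_bigr => i _ do rewrite Ey Ez.
rewrite chord_sum_sqr rotate_sum_sqr.
have := dirichlet_square K x; set CS := (_ + _) => hCS.
have CS0 : 0 <= CS by rewrite addr_ge0 ?sqr_ge0.
have Xn : 0 < X n by rewrite -[n%:R]/(n%:~R) dist_int_irr_gt0 // -lt0n.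
have h1 : pi ^+ 2 * X n ^+ 2 <= 4 * sin x ^+ 2 by exact: sin2_pi_ge.
have h2 : sin z ^+ 2 <= pi ^+ 2 * dist_int (n%:R * gamma) ^+ 2 by exact: sin2_pi_le.
have h3 : sin (K%:R * x) ^+ 2 <= pi ^+ 2 * dist_int (n%:R * (K%:R * alpha)) ^+ 2.
  have -> : K%:R * x = pi * (n%:R * (K%:R * alpha)) by rewrite /x; ring.
  exact: sin2_pi_le.
rewrite mulrA ler_pdivlMr ?exprn_gt0 //.
have p0 := pi_gt0 R; have p2 : 0 < pi ^+ 2 :> R by rewrite exprn_gt0.
rewrite -(ler_pM2l p2).
apply: (le_trans (y := 4 * (sin z ^+ 2 * (CS * (4 * sin x ^+ 2))))).
  have -> : pi ^+ 2 * (4 * sin z ^+ 2 * CS * X n ^+ 2) =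
    4 * (sin z ^+ 2 * (CS * (pi ^+ 2 * X n ^+ 2))) by ring.
  by rewrite ler_wpM2l // ler_wpM2l ?sqr_ge0 // ler_wpM2l.
have -> : 4 * (sin z ^+ 2 * (CS * (4 * sin x ^+ 2))) = 16 * (sin z ^+ 2 * sin (K%:R * x) ^+ 2).
  by rewrite -hCS; ring.
have -> : pi ^+ 2 * (16 * pi ^+ 2 * (dist_int (n%:R * (K%:R * alpha)) ^+ 2 * dist_int (n%:R * gamma) ^+ 2))
  = 16 * ((pi ^+ 2 * dist_int (n%:R * gamma) ^+ 2) * (pi ^+ 2 * dist_int (n%:R * (K%:R * alpha)) ^+ 2)) by ring.
by rewrite ler_wpM2l // ler_pM ?sqr_ge0.
Qed.

(** The translations are indexed by 'I_K * bool, the boolean telling whether gamma is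
added; [fourier_coef_le] bounds the Fourier coefficients of the sum. *)
Lemma orbit_sum_L2 (gamma u G : R) (K : nat) :
  (forall M, \sum_(1 <= n < M) dist_int (n%:R * (K%:R * alpha)) ^+ 2 * dist_int (n%:R * gamma) ^+ 2
     / (n%:R ^+ 2 * X n ^+ 2) <= G) ->
  (\int[mu]_x ((orbit_sum gamma K u x) ^+ 2)%:E <= (8 * G)%:E)%E.
Proof.
move=> hG.
pose c (p : 'I_K * bool) : R := if p.2 then -1 else 1.
pose a (p : 'I_K * bool) : R := u + p.1%:R * alpha + (if p.2 then gamma else 0).
have csum (g : 'I_K -> bool -> R) :
    \sum_(p : 'I_K * bool) c p * g p.1 p.2 = \sum_i (g i false - g i true).
  rewrite -(pair_bigA _ (fun i b => c (i, b) * g i b)) /=; apply: eq_bigr => i _.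
  by rewrite big_bool /c /= mulN1r mul1r addrC.
have c0 : \sum_p c p = 0.
  rewrite (eq_bigr (fun p => c p * 1)); last by move=> p _; rewrite mulr1.
  by rewrite (csum (fun _ _ => 1)) big1 // => i _; rewrite subrr.
have E x : orbit_sum gamma K u x = \sum_p c p * frac_part (x + a p).
  rewrite /a (csum (fun i (b : bool) => frac_part (x + (u + i%:R * alpha + (if b then gamma else 0))))).
  by apply: eq_bigr => i _; rewrite addr0.
under eq_integral => x _ do rewrite E.
rewrite integral_sawtooth_sqr // lee_fin.
pose V M : R := - (\sum_p \sum_p' c p * c p' * (2 / pi ^+ 2 * sin2_sum M (a p - a p'))) / 2.
apply: (cvg_le_cst (f := V)).
  rewrite /V; apply: cvgM; last exact: cvg_cst.
  apply: cvgN; apply: (cvg_seq_sum (f := fun p M => \sum_p' c p * c p' * (2 / pi ^+ 2 * sin2_sum M (a p - a p')))) => p.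
  apply: (cvg_seq_sum (f := fun p' M => c p * c p' * (2 / pi ^+ 2 * sin2_sum M (a p - a p')))) => p'.
  by apply: cvgM; [exact: cvg_cst|exact: parabola_frac_cvg].
move=> M.
have pi0 := pi_gt0 R; have pi2 : 0 < pi ^+ 2 :> R by rewrite exprn_gt0.
pose Fc (n : nat) := (\sum_p c p * cos (pi * (n%:R * a p) *+ 2)) ^+ 2 + (\sum_p c p * sin (pi * (n%:R * a p) *+ 2)) ^+ 2.
have -> : V M = (2 * pi ^+ 2)^-1 * \sum_(k < M) Fc k.+1 / k.+1%:R ^+ 2.
  have E2 p p' : c p * c p' * (2 / pi ^+ 2 * sin2_sum M (a p - a p')) =
     2 / pi ^+ 2 * \sum_(k < M) k.+1%:R ^- 2 * (c p * c p' * sin (pi * (k.+1%:R * a p) - pi * (k.+1%:R * a p')) ^+ 2).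
    rewrite mulrCA; congr (_ * _); rewrite /sin2_sum mulr_sumr; apply: eq_bigr => k _.
    by rewrite -!mulrBr [RHS]mulrC -[RHS]mulrA.
  rewrite /V.
  under eq_bigr => p _ do under eq_bigr => p' _ do rewrite E2.
  under eq_bigr => p _ do rewrite -mulr_sumr exchange_big.
  rewrite -mulr_sumr exchange_big /=.
  have E3 (k : 'I_M) : \sum_p \sum_p' k.+1%:R ^- 2 * (c p * c p' * sin (pi * (k.+1%:R * a p) - pi * (k.+1%:R * a p')) ^+ 2)
    = - (Fc k.+1 / k.+1%:R ^+ 2) / 2.
    under eq_bigr => p _ do rewrite -mulr_sumr.
    rewrite -mulr_sumr (sin2_quadratic_form (fun p => pi * (k.+1%:R * a p)) c0) -/(Fc _).
    by rewrite mulrC !mulNr; congr (- _); rewrite mulrAC.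
  under eq_bigr => k _ do rewrite E3.
  rewrite -mulr_suml sumrN.
  move: pi2 (\sum_(k < M) _); move: (pi ^+ 2) => p p0 s; by field; rewrite gt_eqF.
have FcE n : (0 < n)%N -> Fc n <= 16 * pi ^+ 2 * (dist_int (n%:R * (K%:R * alpha)) ^+ 2 * dist_int (n%:R * gamma) ^+ 2 / X n ^+ 2).
  move=> n0; apply: le_trans (fourier_coef_le gamma u K n0).
  rewrite /Fc /a (csum (fun i (b : bool) => cos (pi * (n%:R * (u + i%:R * alpha + (if b then gamma else 0))) *+ 2))).
  rewrite (csum (fun i (b : bool) => sin (pi * (n%:R * (u + i%:R * alpha + (if b then gamma else 0))) *+ 2))).
  by apply: le_of_eq; congr (_ ^+ 2 + _ ^+ 2); apply: eq_bigr => i _; rewrite addr0.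
rewrite ler_pdivrMl ?mulr_gt0 //.
apply: (le_trans (y := 16 * pi ^+ 2 * G)); last by apply: le_of_eq; ring.
have h0 : 0 <= 16 * pi ^+ 2 :> R by rewrite mulr_ge0 ?(ltW pi2).
apply: le_trans (ler_wpM2l h0 (hG M.+1)).
rewrite big_add1 big_mkord mulr_sumr; apply: ler_sum => k _.
rewrite ler_pdivrMr ?exprn_gt0 //; apply: le_trans (FcE k.+1 _) _ => //.
rewrite -[leRHS]mulrA ler_wpM2l //.
apply: le_of_eq.
have x0 : X k.+1 != 0 by rewrite gt_eqF // -[k.+1%:R]/(k.+1%:~R) dist_int_irr_gt0.
have E4 (p r y n : R) : y != 0 -> n != 0 -> p * r / y ^+ 2 = p * r / (n ^+ 2 * y ^+ 2) * n ^+ 2.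
  by move=> y0 n0; field; rewrite y0.
exact: E4.
Qed.

End orbit_sums.

(** * Summation of geometrically small functions *)

Section L2_series.
Context d (T : measurableType d) (R : realType) (mu : {measure set T -> \bar R}).
Variables (f : nat -> T -> R) (A : R).
Hypothesis mf : forall j, measurable_fun setT (f j).
Hypothesis hf : forall j, (\int[mu]_x ((f j x) ^+ 2)%:E <= (A / 4 ^+ j)%:E)%E.

Lemma sum_inv_pow2_le n : \sum_(j < n) ((2 ^+ j)^-1 : R) <= 2.
Proof.
suff : \sum_(j < n) ((2 ^+ j)^-1 : R) + 2 / 2 ^+ n <= 2.
  have : 0 <= 2 / 2 ^+ n :> R by rewrite divr_ge0 ?exprn_ge0.
  lra.
elim: n => [|n IH]; first by rewrite big_ord0 add0r expr0 divr1.
rewrite big_ord_recr /= exprS invfM.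
have : 0 <= (2 ^+ n)^-1 :> R by rewrite invr_ge0 exprn_ge0.
lra.
Qed.

(** Induction from the front: (x + y)^2 <= 2 x^2 + 2 y^2 with y the sum of the
remaining terms. *)
Lemma sqr_sum_pow2_le (u : nat -> R) n :
  (\sum_(j < n) u j) ^+ 2 <= 2 * \sum_(j < n) 2 ^+ j * u j ^+ 2.
Proof.
elim: n u => [|n IH] u; first by rewrite !big_ord0 expr0n mulr0.
rewrite !big_ord_recl /= expr0 mul1r.
have /= := IH (fun j => u j.+1).
rewrite [X in _ -> _ <= 2 * (_ + X)](eq_bigr (fun i : 'I_n => 2 * (2 ^+ i * u i.+1 ^+ 2))); last first.
  by move=> i _; rewrite /bump /= add1n exprS mulrA.
rewrite -mulr_sumr; set p := \sum_(i < n) u i.+1; set s := \sum_(i < n) _ => h.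
have := sqr_ge0 (u 0%N - p); nra.
Qed.

Let S (x : T) : \bar R := (\sum_(0 <= j <oo) (2 ^+ j * f j x ^+ 2)%:E)%E.

Let term_ge0 j x : 0 <= 2 ^+ j * f j x ^+ 2.
Proof. by rewrite mulr_ge0 ?sqr_ge0 ?exprn_ge0. Qed.

Let mterm j : measurable_fun setT (fun x => (2 ^+ j * f j x ^+ 2)%:E).
Proof. by apply/measurable_EFinP; apply: measurable_funM => //; exact: measurable_funX. Qed.

Let S_ge0 x : (0 <= S x)%E.
Proof. by apply: nneseries_ge0 => j _ _; rewrite lee_fin. Qed.

Let S_partial x n : ((\sum_(j < n) 2 ^+ j * f j x ^+ 2)%:E <= S x)%E.
Proof.
apply: le_trans (nneseries_lim_ge (P := xpredT) n _); last by move=> j _ _; rewrite lee_fin.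
by rewrite sumEFin big_mkord.
Qed.

Let mS : measurable_fun setT S.
Proof. by apply: ge0_emeasurable_sum => // j x _ _; rewrite lee_fin. Qed.

Let intS : (\int[mu]_x S x <= (2 * A)%:E)%E.
Proof.
rewrite integral_nneseries //; last by move=> j x _; rewrite lee_fin.
apply: lime_le.
  by apply: is_cvg_nneseries => j _ _; apply: integral_ge0 => x _; rewrite lee_fin.
apply: nearW => n.
have A0 : 0 <= A.
  have := hf 0; rewrite expr0 divr1 -lee_fin; apply: le_trans.
  by apply: integral_ge0 => x _; rewrite lee_fin sqr_ge0.
apply: (@le_trans _ _ (\sum_(0 <= j < n) (A / 2 ^+ j)%:E)%E).
  apply: lee_sum => j _.
  under eq_integral => x _ do rewrite EFinM.
  have h1 x : setT x -> (0 <= (f j x ^+ 2)%:E)%E by rewrite lee_fin sqr_ge0.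
  have h2 : measurable_fun setT (fun x => (f j x ^+ 2)%:E).
    by apply/measurable_EFinP; exact: measurable_funX.
  have h3 : 0 <= 2 ^+ j :> R by rewrite exprn_ge0.
  rewrite (ge0_integralZl_EFin _ measurableT h1 h2 h3).
  apply: le_trans (lee_wpmul2l _ (hf j)) _; first by rewrite lee_fin exprn_ge0.
  rewrite -EFinM lee_fin; apply: le_of_eq.
  have -> : 4 ^+ j = 2 ^+ j * 2 ^+ j :> R by rewrite -exprMn; congr (_ ^+ _); ring.
  by field; rewrite expf_neq0.
rewrite sumEFin lee_fin -mulr_sumr mulrC ler_wpM2r // big_mkord.
exact: sum_inv_pow2_le.
Qed.

Let S_lty_cvg x : (S x < +oo)%E -> cvg ((fun n => \sum_(j < n) f j x) @ \oo).
Proof.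
move=> Sx.
have -> : (fun n => \sum_(j < n) f j x) = series (fun j => f j x).
  by apply/funext => n; rewrite /series /= big_mkord.
apply: normed_cvg; apply: nondecreasing_is_cvgn.
  by apply: nondecreasing_series => j _ _; exact: normr_ge0.
exists (2 + fine (S x)) => _ [n _ <-]. rewrite /normed_series_of seriesEord /=.
apply: (le_trans (y := \sum_(j < n) ((2 ^+ j)^-1 + 2 ^+ j * f j x ^+ 2))).
  apply: ler_sum => j _; have p0 : 0 < 2 ^+ j :> R by rewrite exprn_gt0.
  rewrite -(real_normK (num_real (f j x))); set p := 2 ^+ j in p0 *.
  have := sqr_ge0 (1 - p * `|f j x|); have := normr_ge0 (f j x).
  move: (`|f j x|) => y y0 h; rewrite -(ler_pM2l p0) mulrDr divff ?gt_eqF //; nra.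
rewrite big_split lerD //=; first exact: sum_inv_pow2_le.
by rewrite -lee_fin fineK; [exact: S_partial|rewrite ge0_fin_numE].
Qed.

(** The function S = \sum_j 2^j f_j^2 is integrable.  Where it is finite the series
converges absolutely, and the square of its sum is at most 2 S.  The limit
superior makes psi measurable; the last clause identifies psi with the limit at
every point of convergence, so that psi can be evaluated at a translate of a
point without appeal to the invariance of null sets. *)
Lemma L2_series_cvg : exists psi : T -> R,
  [/\ psi \in Lfun mu 2%:E,
      {ae mu, forall x, cvg ((fun n => \sum_(j < n) f j x) @ \oo)}
    & forall x l, (fun n => \sum_(j < n) f j x) @ \oo --> l -> psi x = l].
Proof.
pose psi x := fine (limn_esup (fun n => (\sum_(j < n) f j x)%:E)).
have psiE x l : (fun n => \sum_(j < n) f j x) @ \oo --> l -> psi x = l.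
  move=> h; rewrite /psi.
  have h' : (fun n => (\sum_(j < n) f j x)%:E) @ \oo --> l%:E by apply/fine_cvgP; split => //; exact: nearW.
  by have [_ ->] := cvg_limn_einf_sup h'.
have mpsi : measurable_fun setT psi.
  apply: measurableT_comp => //.
  apply: (measurable_fun_limn_esup (f := fun n x => (\sum_(j < n) f j x)%:E)) => n.
  by apply/measurable_EFinP; exact: measurable_sum.
have psi2 x : ((psi x ^+ 2)%:E <= 2%:E * S x)%E.
  have [->|Sx] := eqVneq (S x) +oo%E; first by rewrite gt0_muley ?lte_fin // leey.
  have Sfin : S x \is a fin_num by rewrite ge0_fin_numE // lt_neqAle Sx leey.
  have /cvg_ex [l hl] : cvg ((fun n => \sum_(j < n) f j x) @ \oo).
    by apply: S_lty_cvg; rewrite -ge0_fin_numE.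
  rewrite (psiE x l hl) -(fineK Sfin) -EFinM lee_fin.
  apply: (cvg_le_cst (f := fun n => (\sum_(j < n) f j x) ^+ 2)).
    by under eq_fun do rewrite expr2; rewrite expr2; exact: cvgM.
  move=> n; apply: le_trans (sqr_sum_pow2_le (fun j => f j x) n) _.
  by rewrite ler_wpM2l // -lee_fin fineK //; exact: S_partial.
have int2S : (\int[mu]_x (2%:E * S x) < +oo)%E.
  rewrite ge0_integralZl_EFin //.
  by apply: (@le_lt_trans _ _ (2%:E * (2 * A)%:E)%E); [exact: lee_wpmul2l|rewrite -EFinM ltry].
exists psi; split => //.
- rewrite inE; apply/andP; split; rewrite inE //=.
  rewrite /finite_norm unlock /= poweR_lty //.
  apply: le_lt_trans int2S.
  have E x : (`|psi x| `^ 2)%:E = (psi x ^+ 2)%:E.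
    by rewrite powR_mulrn // real_normK // num_real.
  apply: ge0_le_integral => //.
  + by under eq_fun do rewrite E; apply/measurable_EFinP; exact: measurable_funX.
  + by apply: measurable_funeM.
  + by move=> x _; rewrite E; exact: psi2.
- have iS : mu.-integrable setT S.
    apply/integrableP; split => //.
    under eq_integral => x _ do rewrite gee0_abs //.
    by apply: le_lt_trans intS _; rewrite ltry.
  apply: filterS (integrable_ae measurableT iS) => x /(_ Logic.I) Sx.
  by apply: S_lty_cvg; rewrite -ge0_fin_numE.
Qed.

End L2_series.

(** * The cohomological equation *)

Section sawtooth.
Variable R : realType.
Implicit Types x y : R.

Lemma frac_partDz x (k : int) : frac_part (x + k%:~R) = frac_part x.
Proof.
apply: (frac_partE (k := Num.floor x + k)); first exact: frac_part_itv.
by rewrite intrD addrA /frac_part subrK.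
Qed.

Lemma frac_part_shift x y : frac_part (frac_part x + y) = frac_part (x + y).
Proof.
rewrite -[in RHS](frac_partDz (x + y) (- Num.floor x)) intrN; congr (frac_part _); rewrite /frac_part; ring.
Qed.

(** The fractional part is continuous off the integers. *)
Lemma frac_part_cvg (u : nat -> R) (b y : R) :
  (fun N => dist_int (b - u N)) @ \oo --> (0 : R) -> frac_part (y - b) != 0 ->
  (fun N => frac_part (y - u N)) @ \oo --> frac_part (y - b).
Proof.
move=> hu yb; set t := frac_part (y - b) in yb *.
have /andP[t0 t1] := frac_part_itv (y - b); rewrite -/t in t0 t1.
have tp : 0 < t by rewrite lt_neqAle eq_sym yb.
have d0 : 0 < Num.min t (1 - t) by rewrite lt_min tp subr_gt0.
apply/cvgrPdist_lt => e e0.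
have m0 : 0 < Num.min e (Num.min t (1 - t)) by rewrite lt_min e0.
move/cvgrPdist_lt : hu => /(_ _ m0); apply: filterS => N.
rewrite sub0r normrN ger0_norm ?dist_int_ge0 //.
have [m [-> _]] := dist_int_round (b - u N).
rewrite !lt_min => /and3P[h1 h2 h3].
have -> : frac_part (y - u N) = t + (b - u N - m%:~R).
  apply: (frac_partE (k := Num.floor (y - b) + m)).
    by move: h2 h3; rewrite !ltr_norml; lra.
  by rewrite intrD /t /frac_part; ring.
by rewrite opprD addrA subrr add0r normrN.
Qed.

(** The excluded case y = b modulo 1 is the one where the closed end of the
interval matters. *)
Lemma sawtooth_indic (b y : R) : 0 <= b < 1 -> frac_part (y - b) != 0 ->
  frac_part (y - b) - frac_part y = \1_`[0, b] (frac_part y) - b.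
Proof.
move=> /andP[b0 b1] yb; have /andP[y0 y1] := frac_part_itv y.
rewrite -(frac_part_shift y (- b)) in yb *.
rewrite indicE; move: (frac_part y) y0 y1 yb => v v0 v1 yb.
have vb : v != b by apply/eqP => vb; move: yb; rewrite vb subrr (frac_partE (y := 0) (k := 0)) ?eqxx // ?lexx ?ltr01 // addr0.
have [h|h] := ltP v b.
  rewrite mem_set; last by rewrite /= in_itv /= v0 ltW.
  rewrite (frac_partE (y := v - b + 1) (k := -1)); [ |lra|by rewrite intrN; lra].
  by rewrite /=; lra.
have {}h : b < v by rewrite lt_neqAle eq_sym vb.
rewrite memNset; last by rewrite /= in_itv /= v0 /= leNgt h.
rewrite (frac_partE (y := v - b) (k := 0)); [ |lra|by rewrite addr0].
by rewrite /=; lra.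
Qed.

End sawtooth.

Section increments.
Variables (R : realType) (alpha gamma : R).
Hypotheses (alpha01 : 0 < alpha < 1) (alpha_irr : irrational alpha).
Local Notation mu := (circle_measure R).
Local Notation X n := (dist_int (n%:R * alpha)).

Let f (x : R) := frac_part x - frac_part (x + gamma).

(** The finite sum of translates of f whose coboundary is
f (x + v - k alpha) - f (x + v); for negative k the sum runs in the other
direction. *)
Definition increment (k : int) (v x : R) : R :=
  if k is Posz K then orbit_sum alpha gamma K (v - K%:R * alpha) x
  else - orbit_sum alpha gamma `|k| v x.

Lemma orbit_sum_coboundary K u x :
  orbit_sum alpha gamma K u x - orbit_sum alpha gamma K u (x + alpha) =
  f (x + u) - f (x + (u + K%:R * alpha)).
Proof.
rewrite /orbit_sum -sumrB.
pose h (i : nat) := f (x + (u + i%:R * alpha)).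
rewrite (eq_bigr (fun i : 'I_K => - (h i.+1 - h i))); last first.
  move=> i _; rewrite [RHS]opprB /h /f; congr (_ - _).
    by congr (_ - frac_part _); ring.
  rewrite -natr1; congr (frac_part _ - frac_part _); ring.
rewrite sumrN -(big_mkord xpredT (fun i => h i.+1 - h i)) telescope_sumr // opprB.
by rewrite /h mul0r addr0.
Qed.

Lemma increment_coboundary k v x :
  increment k v x - increment k v (x + alpha) = f (x + (v - k%:~R * alpha)) - f (x + v).
Proof.
case: k => K.
  rewrite /increment orbit_sum_coboundary; congr (_ - f _).
  by rewrite subrK.
rewrite /increment -opprD orbit_sum_coboundary opprB; congr (f _ - _).
by rewrite NegzE intrN abszN /= mulNr opprK.
Qed.

Lemma increment_L2 k v G :
  (forall M, \sum_(1 <= n < M) dist_int (n%:R * (k%:~R * alpha)) ^+ 2 * dist_int (n%:R * gamma) ^+ 2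
     / (n%:R ^+ 2 * X n ^+ 2) <= G) ->
  (\int[mu]_x ((increment k v x) ^+ 2)%:E <= (8 * G)%:E)%E.
Proof.
case: k => K hG; first exact: orbit_sum_L2.
rewrite /increment; under eq_integral => x _ do rewrite sqrrN.
apply: orbit_sum_L2 => // M; apply: le_trans (hG M).
apply: le_of_eq; apply: eq_bigr => n _; congr (_ ^+ 2 * _ / _).
by rewrite NegzE intrN abszN /= mulNr mulrN dist_intN.
Qed.

Lemma measurable_increment k v :
  measurable_fun setT (increment k v : measurableTypeR R -> measurableTypeR R).
Proof.
have H K u : measurable_fun setT (orbit_sum alpha gamma K u : measurableTypeR R -> measurableTypeR R).
  by apply: measurable_sum => i; apply: measurable_funB; exact: measurable_frac_shift.
case: k => K; first exact: H.
exact: measurableT_comp (H _ _).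
Qed.

Lemma increment_frac k v x : increment k v (frac_part x) = increment k v x.
Proof.
have H K u : orbit_sum alpha gamma K u (frac_part x) = orbit_sum alpha gamma K u x.
  by apply: eq_bigr => i _; rewrite !frac_part_shift.
by case: k => K; rewrite /increment H.
Qed.

End increments.

Section solution.
Variables (R : realType) (alpha : R).
Hypotheses (alpha01 : 0 < alpha < 1) (alpha_irr : irrational alpha).
Local Notation mu := (circle_measure R).
Local Notation X n := (dist_int (n%:R * alpha)).

Lemma energy_bound_small (eps : R) : 0 < eps -> exists2 T, 0 < T & energy_bound T <= eps.
Proof.
move=> e0; pose C : R := 27 * 64 * 81 * 3.
have C0 : 0 < C by rewrite /C !mulr_gt0.
exists (Num.min 1 (eps / C)); first by rewrite lt_min ltr01 divr_gt0.
set T := Num.min _ _.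
have T0 : 0 <= T by rewrite le_min ler01 divr_ge0 ?(ltW e0) ?(ltW C0).
have T1 : T <= 1 by rewrite ge_min lexx.
have T2 : C * T <= eps by rewrite mulrC -ler_pdivlMr // ge_min lexx orbT.
apply: le_trans T2; rewrite /energy_bound /C -[leRHS]mulrA ler_wpM2l //.
have h2 : T ^+ 2 <= T by rewrite -[leRHS]expr1 ler_wiXn2l.
have h4 : T ^+ 4 <= T by rewrite -[leRHS]expr1 ler_wiXn2l.
lra.
Qed.

(** The weight s = 2 (G + 1) / eps makes the share of gamma at most eps / 2; the
tail of the weights of c is then taken small enough for the other half. *)
Lemma pair_energy_small (c : nat -> int) (gamma G eps : R) : 0 < eps ->
  (forall eps, 0 < eps -> exists N0, forall N N', (N0 <= N <= N')%N ->
     \sum_(N <= j < N') weight alpha c j <= eps) ->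
  (forall K, \sum_(1 <= n < K) dist_int (n%:R * gamma) ^+ 4 / (n%:R ^+ 2 * X n ^+ 2) <= G) ->
  exists N0, forall N N', (N0 <= N <= N')%N -> forall K,
    \sum_(1 <= n < K) dist_int (n%:R * ((shift_num alpha c N N')%:~R * alpha)) ^+ 2
      * dist_int (n%:R * gamma) ^+ 2 / (n%:R ^+ 2 * X n ^+ 2) <= eps.
Proof.
move=> e0 htail hG.
have G0 : 0 <= G by have := hG 0%N; rewrite big_geq.
have [s sE] : exists s, s = 2 * (G + 1) / eps by exists (2 * (G + 1) / eps).
have s0 : 0 < s by rewrite sE divr_gt0 // mulr_gt0 // ltr_wpDl.
have [T T0 hT] := energy_bound_small (divr_gt0 e0 (mulr_gt0 (ltr0n _ 2) s0)).
have [N0 hN0] := htail T T0.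
exists N0 => N N' /hN0 hN K.
have h1 := energy_le alpha01 alpha_irr K hN.
apply: le_trans (pair_energy_le (x := fun n => dist_int (n%:R * ((shift_num alpha c N N')%:~R * alpha)))
  (y := fun n => dist_int (n%:R * gamma)) s0 h1 (hG K)) _.
have h2 : s * energy_bound T <= eps / 2.
  apply: le_trans (ler_wpM2l (ltW s0) hT) _; by apply: le_of_eq; field; rewrite gt_eqF.
have h3 : G / s <= eps / 2.
  rewrite ler_pdivrMr // sE.
  have -> : eps / 2 * (2 * (G + 1) / eps) = G + 1 by field; rewrite gt_eqF.
  lra.
lra.
Qed.

Lemma ae_frac_neq0 (b : R) : {ae mu, forall x : R, frac_part (x - b) != 0}.
Proof.
pose B : set R := range (fun k : int => k%:~R + b).
have cB : countable B by apply: card_le_trans (card_image_le _ _) _; exact: countableP.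
have mB : measurable (B : set (measurableTypeR R)) by apply: countable_measurable.
exists B; split => //.
  apply/eqP; rewrite eq_le measure_ge0 andbT circle_measureE.
  rewrite -(countable_lebesgue_measure0 cB); apply: le_measure; rewrite ?inE //.
  exact: measurableI.
move=> x /= /negP; rewrite negbK /frac_part subr_eq0 => /eqP h.
by exists (Num.floor (x - b)) => //; rewrite -h subrK.
Qed.

Lemma ae_circle : {ae mu, forall x : R, 0 <= x < 1}.
Proof.
exists (~` `[0, 1[%classic : set R); split; first exact: measurableC.
  by rewrite circle_measureE setICl measure0.
by move=> x /= h; rewrite in_itv.
Qed.

(** Convergence of the partial sums at x implies convergence at x + alpha, because
their difference is f (x - s_J) - f (x), which converges unless x or x + gamma
is beta modulo 1. *)
Lemma coboundary_solution (beta gamma : R) : H 4 alpha beta -> H 4 alpha gamma ->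
  exists psi : R -> R, psi \in Lfun mu 2%:E /\
    {ae mu, forall x : R, \1_`[0, beta] x - translate gamma \1_`[0, beta] x
        = psi x - translate alpha psi x}.
Proof.
move=> Hb Hg; have [b01 _] := Hb.
have [c [T [hc hT htail]]] := H_data Hb.
have [G hG] := energy_H alpha01 alpha_irr Hg.
have G0 : 0 <= G by have := hG 0%N; rewrite big_geq.
have e4 j : 0 < (4 ^+ j)^-1 :> R by rewrite invr_gt0 exprn_gt0.
have [Nf hNf] := choice (fun j => pair_energy_small (e4 j) htail hG).
(* Strictly increasing cut-offs, chosen so that the increment of index j + 1 has
   squared norm at most 8 / 4^j. *)
pose ns := fix F (j : nat) : nat := if j is j'.+1 then maxn (F j').+1 (Nf j') else 0%N.
have nsS j : (ns j < ns j.+1)%N by rewrite /= leq_maxl.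
have ns_ge j : (j <= ns j)%N by elim: j => // j IH; apply: leq_ltn_trans IH (nsS j).
have nsN j : (Nf j <= ns j.+1)%N by rewrite /= leq_maxr.
pose s j : R := (shift_num alpha c 0 (ns j))%:~R * alpha.
pose k j := shift_num alpha c (ns j) (ns j.+1).
have sS j : s j.+1 = s j + (k j)%:~R * alpha.
  by rewrite /s /k -mulrDl -intrD /shift_num -big_cat_nat //= ltnW.
pose d j := increment alpha gamma (k j) (- s j).
pose A0 := energy_bound T + G.
have A0h : forall M, \sum_(1 <= n < M) dist_int (n%:R * ((k 0%N)%:~R * alpha)) ^+ 2
    * dist_int (n%:R * gamma) ^+ 2 / (n%:R ^+ 2 * X n ^+ 2) <= A0.
  move=> M; have hT1 : \sum_(ns 0 <= j < ns 1) weight alpha c j <= T by rewrite big_mkord.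
  have h1 := energy_le alpha01 alpha_irr M hT1.
  apply: le_trans (pair_energy_le (x := fun n => dist_int (n%:R * ((k 0%N)%:~R * alpha)))
    (y := fun n => dist_int (n%:R * gamma)) ltr01 h1 (hG M)) _.
  by rewrite mul1r divr1.
have A00 : 0 <= A0 by have := A0h 0%N; rewrite big_geq.
(* 8 A0 covers the first increment, and 32 / 4^(j+1) = 8 / 4^j the others. *)
pose A := 8 * A0 + 32.
have dL2 j : (\int[mu]_x ((d j x) ^+ 2)%:E <= (A / 4 ^+ j)%:E)%E.
  case: j => [|j].
    apply: le_trans (increment_L2 alpha_irr _ A0h) _.
    by rewrite lee_fin expr0 divr1 /A; lra.
  apply: le_trans (increment_L2 alpha_irr _ (hNf j _ _ _)) _.
    by rewrite nsN ltnW.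
  rewrite lee_fin exprS invfM mulrA ler_wpM2r ?(ltW (e4 j)) // /A; lra.
have md j : measurable_fun setT (d j : measurableTypeR R -> measurableTypeR R).
  exact: measurable_increment.
have [psi [psiL psiC psiE]] := L2_series_cvg md dL2.
exists psi; split=> //.
pose f (x : R) := frac_part x - frac_part (x + gamma).
have cob J x : \sum_(j < J) d j x - \sum_(j < J) d j (x + alpha) = f (x - s J) - f x.
  rewrite -sumrB (eq_bigr (fun j : 'I_J => f (x - s j.+1) - f (x - s j))); last first.
    by move=> j _; rewrite /d increment_coboundary sS [- (s j + _)]opprD.
  rewrite -(big_mkord xpredT (fun j => f (x - s j.+1) - f (x - s j))) telescope_sumr //.
  have -> : s 0%N = 0 by rewrite /s /shift_num big_geq //; exact: mul0r.
  by rewrite subr0.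
have hs : (fun J => dist_int (beta - s J)) @ \oo --> (0 : R).
  have hns : ns @ \oo --> \oo.
    by apply/cvgnyPge => M; exists M => // n /= Mn; apply: leq_trans (ns_ge n).
  exact: (cvg_comp ns (fun N => dist_int (beta - (shift_num alpha c 0 N)%:~R * alpha)) hns hc).
apply: filterS3 psiC (ae_frac_neq0 beta) (filterI ae_circle (ae_frac_neq0 (beta - gamma))).
move=> x /cvg_ex [l hl] xb [x01 xg].
have {}xg : frac_part (x + gamma - beta) != 0.
  by move: xg; rewrite opprB addrA addrAC.
have h1 := frac_part_cvg hs xb; have h2 := frac_part_cvg hs xg.
have hf : (fun J => f (x - s J)) @ \oo --> f (x - beta).
  rewrite /f; under eq_fun do rewrite [x - _ + gamma]addrAC; rewrite [x - _ + gamma]addrAC.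
  exact: cvgB h1 h2.
have hl' : (fun J => \sum_(j < J) d j (frac_part (x + alpha))) @ \oo --> l - (f (x - beta) - f x).
  have -> : (fun J => \sum_(j < J) d j (frac_part (x + alpha))) =
      (fun J => \sum_(j < J) d j x - (f (x - s J) - f x)).
    apply/funext => J; rewrite -cob subKr.
    by apply: eq_bigr => j _; rewrite /d increment_frac.
  by apply: cvgB => //; apply: cvgB => //; exact: cvg_cst.
rewrite /translate (psiE _ _ hl) (psiE _ _ hl') subKr.
have fx : frac_part x = x by apply: (frac_partE (k := 0)); rewrite ?addr0.
have i1 := sawtooth_indic b01 xb; have i2 := sawtooth_indic b01 xg.
rewrite fx in i1; rewrite /f fx [x - _ + gamma]addrAC; lra.
Unshelve. exact: (ae_filter_ringOfSetsType mu).
Qed.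

End solution.

Unset Implicit Arguments.
Set Strict Implicit.

Theorem theorem2p2 (R : realType) (alpha : R)
    (alpha01 : 0 < alpha < 1) (alpha_irr : irrational alpha) :
  (forall beta : R, H 4 alpha beta ->
    (\esum_(n in [set n : int | n != 0%R])
       (1 / n%:~R ^+ 2 *
        (dist_int (n%:~R * beta) ^+ 4 / dist_int (n%:~R * alpha) ^+ 2))%:E
     < +oo)%E) /\
  (forall beta gamma : R, H 4 alpha beta -> H 4 alpha gamma ->
    (\esum_(n in [set n : int | n != 0%R])
       (1 / n%:~R ^+ 2 *
        (dist_int (n%:~R * beta) ^+ 2 * dist_int (n%:~R * gamma) ^+ 2
         / dist_int (n%:~R * alpha) ^+ 2))%:E
     < +oo)%E /\
    exists psi : R -> R,
      psi \in Lfun (circle_measure R) 2%:E /\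
      {ae circle_measure R, forall x : R,
        \1_`[0, beta] x - translate gamma \1_`[0, beta] x
        = psi x - translate alpha psi x}).
Proof.
have dabs (n : int) (x : R) : dist_int (n%:~R * x) = dist_int (`|n|%N%:R * x).
  by case: n => n; rewrite ?NegzE ?intrN ?mulNr ?dist_intN ?abszN.
have nabs (n : int) : (n%:~R ^+ 2 : R) = `|n|%N%:R ^+ 2.
  by case: n => n; rewrite ?NegzE ?intrN ?sqrrN ?abszN.
split=> [beta Hb|beta gamma Hb Hg].
  have [G hG] := energy_H alpha01 alpha_irr Hb.
  apply: (esum_int_lty (F := fun n => dist_int (n%:R * beta) ^+ 4
      / (n%:R ^+ 2 * dist_int (n%:R * alpha) ^+ 2))) hG.
    by move=> n; rewrite divr_ge0 ?exprn_ge0 ?mulr_ge0 ?exprn_ge0 ?dist_int_ge0.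
  by move=> n _; rewrite !dabs nabs div1r [in RHS]invfM [RHS]mulrCA.
split; last exact: coboundary_solution.
have [G1 hG1] := energy_H alpha01 alpha_irr Hb.
have [G2 hG2] := energy_H alpha01 alpha_irr Hg.
apply: (esum_int_lty (G := 1 * G1 + G2 / 1) (F := fun n =>
    dist_int (n%:R * beta) ^+ 2 * dist_int (n%:R * gamma) ^+ 2
    / (n%:R ^+ 2 * dist_int (n%:R * alpha) ^+ 2))).
- by move=> n; rewrite divr_ge0 ?mulr_ge0 ?exprn_ge0 ?dist_int_ge0.
- by move=> n _; rewrite !dabs nabs div1r [in RHS]invfM [RHS]mulrCA.
- move=> K; exact: (pair_energy_le (x := fun n => dist_int (n%:R * beta))
    (y := fun n => dist_int (n%:R * gamma)) ltr01 (hG1 K) (hG2 K)).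
Qed.
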